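(* Let $Z<0$, $N\ge2$ and $n\in\{1,\dots,N-1\}$ be fixed. Assume $\omega>\omega_n^*$. The operator $\mathcal L_{-,Z}=\operatorname{diag}(\mathcal L_{-,1},\dots,\mathcal L_{-,1},\mathcal L_{-,N},\dots,\mathcal L_{-,N})$ ($\mathcal L_{-,1}$ repeated $n$ times, $\mathcal L_{-,N}$ repeated $N-n$ times), with domain $D(\mathcal L_{-,Z})=D(\mathcal H_Z^{\delta'})$ and $$\mathcal L_{-,1}=-\partial_x^2+\omega-\Psi_{a_1}^2,\qquad \mathcal L_{-,N}=-\partial_x^2+\omega-\Psi_{a_N}^2,$$ satisfies: (1) for $j\in\{1,N\}$, if $D(\mathcal H_Z^{\delta'})\cap X_{j,\perp}\ne\{\mathbf 0\}$ then $\mathcal L_{-,Z}\ge0$ on $D(\mathcal H_Z^{\delta'})\cap X_{j,\perp}$; (2) $\mathcal L_{-,Z}\ge0$ on $D(\mathcal H_Z^{\delta'})\cap X_{\mathrm{mean}}$; (3) $\operatorname{Ker}(\mathcal L_{-,Z})=\operatorname{span}\{\Theta_{\omega,n}\}\subset D(\mathcal H_Z^{\delta'})\cap X_{\mathrm{mean}}$.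
   Context: Star graph: $\mathcal G$ consists of $N$ half-lines, each identified with $[L,\infty)$, $L\ge 0$, joined at the vertex $x=L$. Functions are $N$-tuples $(\psi_j)_{j=1}^N$; $L^2(\mathcal G)=\bigoplus_{j=1}^N L^2(L,\infty)$, $H^2(\mathcal G)=\bigoplus_{j=1}^N H^2(L,\infty)$, and $$D(\mathcal H_Z^{\delta'})=\Big\{(\psi_j)\in H^2(\mathcal G):\ \psi_1'(L)=\dots=\psi_N'(L),\ \sum_{j=1}^N\psi_j(L)=Z\psi_1'(L)\Big\}.$$ With $A=\{1,\dots,n\}$, $B=\{n+1,\dots,N\}$: $X_{\mathrm{mean}}=\{\mathbf v\in L^2(\mathcal G): v_1\equiv\dots\equiv v_n,\ v_{n+1}\equiv\dots\equiv v_N\}$, $X_{1,\perp}=\{\mathbf v\in L^2(\mathcal G): v_j\equiv0\ \forall j\in B,\ \sum_{j\in A}v_j\equiv0\}$, $X_{N,\perp}=\{\mathbf v\in L^2(\mathcal G): v_j\equiv0\ \forall j\in A,\ \sum_{j\in B}v_j\equiv0\}$. ''$T\ge0$ on $S$'' means $\langle T\mathbf v,\mathbf v\rangle_{L^2(\mathcal G)}\ge0$ for all $\mathbf v\in S$. Profiles: for $\omega>0$, $\Psi_a(x)=\sqrt{2\omega}\,\operatorname{sech}(\sqrt\omega(x-L)+a)$, $x\ge L$. Put $\alpha_n(t)=\frac nt+\frac{N-n}{\sqrt{1-t^2}}$, $t\in(0,1)$, with unique minimizer $t_n^*=\big(\frac{n^{2/3}}{n^{2/3}+(N-n)^{2/3}}\big)^{1/2}$,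 and $\omega_n^*=\alpha_n(t_n^* )^2/Z^2=(n^{2/3}+(N-n)^{2/3})^3/Z^2$. For $\omega>\omega_n^*$ let $t_1$ be the unique element of $(0,t_n^* )$ with $\alpha_n(t_1)=-Z\sqrt\omega$, $t_N=\sqrt{1-t_1^2}$, $a_1=\operatorname{arctanh}t_1$, $a_N=\operatorname{arctanh}t_N$, and $\Theta_{\omega,n}=(\Psi_{a_1},\dots,\Psi_{a_1},\Psi_{a_N},\dots,\Psi_{a_N})$, with $\Psi_{a_1}$ repeated $n$ times and $\Psi_{a_N}$ repeated $N-n$ times. *)

(* Defs.v *)
(* The complex numbers are R[i] (mathcomp-real-closed) over
   an arbitrary R : realType. *)
From mathcomp Require Import all_boot all_order all_algebra.
From mathcomp Require Import complex.
From mathcomp Require Import all_classical all_reals all_analysis.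

Set Implicit Arguments.
Unset Strict Implicit.
Unset Printing Implicit Defensive.

Import Order.TTheory GRing.Theory Num.Theory.
Import numFieldNormedType.Exports.

Local Open Scope classical_set_scope.
Local Open Scope ring_scope.
Local Open Scope complex_scope.

Section HalfLine.
Context {R : realType}.
Local Notation mu := (@lebesgue_measure R).

Definition half_line (L : R) : set R := `[L, +oo[.

(* Elements of L^2(L, +oo) and of the spaces built on it are represented by
   functions R -> R[i]; only their values on [L, +oo[, up to null sets, matter. *)
Definition L2_real (L : R) (f : R -> R) : Prop :=
  measurable_fun (half_line L) f /\
  mu.-integrable (half_line L) (fun x => (f x ^+ 2)%:E).

Definition L2 (L : R) (f : R -> R[i]) : Prop :=
  L2_real L (fun x => complex.Re (f x)) /\ L2_real L (fun x => complex.Im (f x)).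

Definition ae_equal (L : R) (f g : R -> R[i]) : Prop :=
  f = g %[ae mu in half_line L].

Definition Cintegral (L : R) (f : R -> R[i]) : R[i] :=
  Rintegral mu (half_line L) (fun x => complex.Re (f x)) +i*
  Rintegral mu (half_line L) (fun x => complex.Im (f x)).

(* C^1 functions with compact support in the open half-line ]L, +oo[; they
   define the same weak derivatives as the C^oo ones. *)
Definition test_function (L : R) (phi : R -> R) : Prop :=
  [/\ forall x, derivable phi x 1,
      continuous (derive1 phi) &
      exists a b : R, L < a /\ forall x, x \notin `[a, b] -> phi x = 0].

Definition is_weak_derivative (L : R) (f g : R -> R[i]) : Prop :=
  L2 L g /\
  forall phi : R -> R, test_function L phi ->
    Cintegral L (fun x => f x * (derive1 phi x)%:C) =
    - Cintegral L (fun x => g x * (phi x)%:C).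

(* A representative of the weak derivative, which is unique up to null sets;
   the default value 0 is never used on H1. *)
Definition wderiv (L : R) (f : R -> R[i]) : R -> R[i] :=
  xget (fun=> 0) [set g | is_weak_derivative L f g].

Definition H1 (L : R) (f : R -> R[i]) : Prop :=
  L2 L f /\ exists g, is_weak_derivative L f g.

Definition H2 (L : R) (f : R -> R[i]) : Prop :=
  H1 L f /\ H1 L (wderiv L f).

(* The boundary value f(L) of f in H1: the value at L of the representative
   of f that is continuous on the closed half-line. *)
Definition bdry_value (L : R) (f : R -> R[i]) : R[i] :=
  xget 0 [set c | exists h : R -> R[i],
    [/\ {within half_line L, continuous (fun x => complex.Re (h x))},
        {within half_line L, continuous (fun x => complex.Im (h x))},
        ae_equal L f h &
        h L = c]].

End HalfLine.

Section StarGraph.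
Context {R : realType}.

(* Edge j in {1, ..., N} is the ordinal of value j - 1;
   thus A = {1, ..., n} is i < n, and B = {n + 1, ..., N} is n <= i. *)
Definition graph_fun (N : nat) := 'I_N -> R -> R[i].

Definition L2G (L : R) (N : nat) : set (graph_fun N) :=
  [set v | forall i, L2 L (v i)].

Definition H2G (L : R) (N : nat) : set (graph_fun N) :=
  [set v | forall i, H2 L (v i)].

(* L2 asks for Borel representatives, and a function a.e. equal to a Borel one
   need not be Borel: hence the explicit L2G in the two spaces below. *)
Definition ae_equalG (L : R) (N : nat) (v w : graph_fun N) : Prop :=
  forall i, ae_equal L (v i) (w i).

Definition zero_space (L : R) (N : nat) : set (graph_fun N) :=
  [set v | L2G L v /\ ae_equalG L v (fun _ _ => 0)].

Definition spanG (L : R) (N : nat) (u : graph_fun N) : set (graph_fun N) :=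
  [set v | L2G L v /\ exists c : R[i], ae_equalG L v (fun i x => c * u i x)].

Definition innerG (L : R) (N : nat) (v w : graph_fun N) : R[i] :=
  \sum_(i < N) Cintegral L (fun x => v i x * (w i x)^*).

Record operator (N : nat) := Operator {
  op_dom : set (graph_fun N);
  op_fun : graph_fun N -> graph_fun N
}.

(* The order on R[i] makes 0 <= z mean "z is real and nonnegative". *)
Definition op_nonneg_on (L : R) (N : nat) (T : operator N)
    (S : set (graph_fun N)) : Prop :=
  forall v, S v -> 0 <= innerG L (op_fun T v) v.

Definition Ker (L : R) (N : nat) (T : operator N) : set (graph_fun N) :=
  [set v | op_dom T v /\ ae_equalG L (op_fun T v) (fun _ _ => 0)].

Definition dom_delta' (L Z : R) (N : nat) : set (graph_fun N) :=
  [set psi | [/\ H2G L psi,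
    forall i j, bdry_value L (wderiv L (psi i)) = bdry_value L (wderiv L (psi j)) &
    forall i : 'I_N, i = 0%N :> nat ->
      \sum_(j < N) bdry_value L (psi j) = Z%:C * bdry_value L (wderiv L (psi i))]].

Definition Xmean (L : R) (N n : nat) : set (graph_fun N) :=
  [set v | [/\ L2G L v,
    forall i j : 'I_N, (i < n)%N -> (j < n)%N -> ae_equal L (v i) (v j) &
    forall i j : 'I_N, (n <= i)%N -> (n <= j)%N -> ae_equal L (v i) (v j)]].

Definition X1perp (L : R) (N n : nat) : set (graph_fun N) :=
  [set v | [/\ L2G L v,
    forall j : 'I_N, (n <= j)%N -> ae_equal L (v j) (fun=> 0) &
    ae_equal L (fun x => \sum_(j < N | (j < n)%N) v j x) (fun=> 0)]].

Definition XNperp (L : R) (N n : nat) : set (graph_fun N) :=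
  [set v | [/\ L2G L v,
    forall j : 'I_N, (j < n)%N -> ae_equal L (v j) (fun=> 0) &
    ae_equal L (fun x => \sum_(j < N | (n <= j)%N) v j x) (fun=> 0)]].

End StarGraph.

Arguments zero_space {R} L N.
Arguments dom_delta' {R} L Z N.
Arguments Xmean {R} L N n.
Arguments X1perp {R} L N n.
Arguments XNperp {R} L N n.

Section Profiles.
Context {R : realType}.

Definition sech (x : R) : R := 2 / (expR x + expR (- x)).

Definition arctanh (t : R) : R := ln ((1 + t) / (1 - t)) / 2.

Definition Psi (L omega a x : R) : R :=
  Num.sqrt (2 * omega) * sech (Num.sqrt omega * (x - L) + a).

Definition alpha (N n : nat) (t : R) : R :=
  n%:R / t + (N%:R - n%:R) / Num.sqrt (1 - t ^+ 2).

Definition t_star (N n : nat) : R :=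
  Num.sqrt (n%:R `^ (2 / 3) /
            (n%:R `^ (2 / 3) + (N%:R - n%:R) `^ (2 / 3))).

Definition omega_star (Z : R) (N n : nat) : R :=
  alpha N n (t_star N n) ^+ 2 / Z ^+ 2.

(* For omega > omega_star this set is a singleton. *)
Definition t_1 (Z omega : R) (N n : nat) : R :=
  xget 0 [set t | 0 < t < t_star N n /\ alpha N n t = - Z * Num.sqrt omega].

Definition t_N (Z omega : R) (N n : nat) : R :=
  Num.sqrt (1 - t_1 Z omega N n ^+ 2).

Definition a_1 (Z omega : R) (N n : nat) : R := arctanh (t_1 Z omega N n).
Definition a_N (Z omega : R) (N n : nat) : R := arctanh (t_N Z omega N n).

Definition edge_shift (Z omega : R) (N n : nat) (i : 'I_N) : R :=
  if (i < n)%N then a_1 Z omega N n else a_N Z omega N n.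

Definition Theta (L Z omega : R) (N n : nat) : graph_fun N :=
  fun i x => (Psi L omega (edge_shift Z omega n i) x)%:C.

Definition Lminus_edge (L omega a : R) (f : R -> R[i]) : R -> R[i] :=
  fun x => - wderiv L (wderiv L f) x + omega%:C * f x
           - (Psi L omega a x ^+ 2)%:C * f x.

Definition Lminus (L Z omega : R) (N n : nat) : operator N :=
  Operator (dom_delta' L Z N)
    (fun v i => Lminus_edge L omega (edge_shift Z omega n i) (v i)).

End Profiles.

Arguments Theta {R} L Z omega N n.
Arguments Lminus {R} L Z omega N n.

(* Main.v *)
(* If b = Psi' / Psi then b' + b^2 = omega - Psi^2, so on each edge
   (-v'' + omega v - Psi^2 v) conj(v) = |v' - b v|^2 + (-v' conj(v) + b |v|^2)'.
   Integrating and summing over the edges, with d the common value of v_j'(L)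
   and t_j = tanh a_j, the boundary terms add up to
   Z |d|^2 + sqrt omega * sum_j t_j |v_j(L)|^2. Since sum_j v_j(L) = Z d and
   sum_j 1 / t_j = - Z sqrt omega, this is the sum of squares
   sqrt omega * sum_j t_j |v_j(L) + d / (sqrt omega t_j)|^2, so the operator is
   nonnegative on its whole domain, not only on the three subspaces. On the
   kernel v_j' = b v_j, hence v_j = c_j Psi_j; the numbers Psi_j'(L) are nonzero
   and do not depend on j, so the c_j are equal. *)
Require Import Defs.
From mathcomp Require Import all_boot all_order all_algebra.
From mathcomp Require Import complex.
From mathcomp Require Import all_classical all_reals all_analysis.
From mathcomp Require Import measurable_realfun.
From mathcomp Require Import ring lra.

Set Implicit Arguments.
Unset Strict Implicit.
Unset Printing Implicit Defensive.

Import Order.TTheory GRing.Theory Num.Theory.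
Import numFieldNormedType.Exports.

Local Open Scope classical_set_scope.
Local Open Scope ring_scope.
Local Open Scope complex_scope.

#[local] Hint Extern 0 (measurable (half_line _)) =>
  solve [apply: measurable_itv] : core.

(** * Primitives on a half-line *)

Section Primitives.
Context {R : realType}.
Implicit Types (L x y z : R) (f g F G : R -> R).
Local Notation mu := (@lebesgue_measure R).

(** An element of [H2] is an a.e. class whose second weak derivative is merely square integrable, so
    the identity for [v' - b v] cannot be integrated with classical derivatives. It is integrated
    for continuous representatives [P], [P1] tied together by [primitive], that is, by integrals of
    densities. This calculus needs a product rule ([primitiveM]), a fundamental theorem on the
    half-line ([FTC_half_line]) and the du Bois-Reymond lemma, which produces the representatives.
    Nothing is left at infinity because the boundary expressions and their densities are sums of
    products of L2 functions, up to bounded factors, hence integrable. The estimates concern real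
    functions only: the coefficients and [Z] are real, so real and imaginary parts satisfy the
    vertex conditions separately, and the imaginary part of the form is a sum of Wronskians at the
    vertex, which the same conditions cancel. The slopes [Psi_j'(L)] agree because they are a
    constant times [t_j * sqrt (1 - t_j ^+ 2)], and the map from [t] to [sqrt (1 - t ^+ 2)]
    exchanges [t_1] and [t_N]. *)

Definition locint L f := forall x, mu.-integrable `[L, x] (EFin \o f).

(** Local absolute continuity on the closed half-line with an explicit density. No pointwise
    derivative is mentioned, so [f] may be changed on a null set. *)
Definition primitive L F f :=
  locint L f /\ forall x, L <= x -> F x = F L + \int[mu]_(t in `[L, x]) f t.

Lemma locint_sub L f y x : L <= y -> locint L f ->
  mu.-integrable `[y, x] (EFin \o f).
Proof.
move=> Ly lf; apply: integrableS (lf x) => //.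
by apply: subset_itvr; rewrite bnd_simp.
Qed.

Lemma Rintegral_split f (a b c : R) : a <= b -> b <= c ->
  mu.-integrable `[a, c] (EFin \o f) ->
  \int[mu]_(t in `[a, c]) f t =
  \int[mu]_(t in `[a, b]) f t + \int[mu]_(t in `[b, c]) f t.
Proof.
move=> ab bc fi.
have := @Rintegral_itvB _ f (BLeft a) (BRight c) b fi.
rewrite !bnd_simp => /(_ ab bc).
rewrite Rintegral_itv_obnd_cbnd => [<-|]; first by rewrite addrC subrK.
apply: integrableS fi => //; apply: subset_itvr.
by rewrite bnd_simp.
Qed.

Lemma primitive_sub L F f y x : primitive L F f -> L <= y -> y <= x ->
  F x - F y = \int[mu]_(t in `[y, x]) f t.
Proof.
move=> [lf Ff] Ly yx; rewrite (Ff x (le_trans Ly yx)) (Ff y Ly).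
by rewrite (Rintegral_split Ly yx (lf x)); ring.
Qed.

Lemma within_half_line L f : (forall x, L <= x -> {within `[L, x], continuous f}) ->
  {within half_line L, continuous f}.
Proof.
move=> h.
have LL1 : L < L + 1 by rewrite ltrDl.
apply/continuous_within_itvcyP; split.
  move=> x; rewrite in_itv/= andbT => Lx.
  have Lx1 : L < x + 1 by rewrite (lt_trans Lx)// ltrDl.
  have /(continuous_within_itvP _ Lx1)[+ _ _] := h _ (ltW Lx1).
  by apply; rewrite in_itv/= Lx ltrDl/=.
by have /(continuous_within_itvP _ LL1)[_ + _] := h _ (ltW LL1).
Qed.

Lemma primitive_within L F f : primitive L F f ->
  forall x, L <= x -> {within `[L, x], continuous F}.
Proof.
move=> [lf Ff] x Lx.
have ct := parameterized_integral_continuous Lx (lf x).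
have ct2 : {within `[L, x], continuous
    (fun y => F L + \int[mu]_(t in `[L, y]) f t)}.
  by move=> y; apply: (@cvgD _ R^o); [exact: cvg_cst|exact: ct].
apply: (subspace_eq_continuous _ ct2) => y; rewrite /from_subspace inE/= in_itv/= => /andP[Ly _].
by rewrite -Ff.
Qed.

Lemma primitive_continuous L F f : primitive L F f ->
  {within half_line L, continuous F}.
Proof. by move/primitive_within/within_half_line. Qed.

Lemma half_lineE L x : half_line L x = (L <= x) :> Prop.
Proof. by rewrite /half_line/= in_itv/= andbT. Qed.

Lemma half_line_sub L x : `[L, x] `<=` half_line L.
Proof. by apply: subset_itvl; rewrite bnd_simp. Qed.

Lemma within_locint L f : {within half_line L, continuous f} -> locint L f.
Proof.
move=> cf x; apply: continuous_compact_integrable; first exact: segment_compact.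
exact: (continuous_subspaceW (@half_line_sub L x)).
Qed.

Lemma locint_cst L (c : R) : locint L (fun=> c).
Proof. by apply: within_locint; apply: continuous_subspaceT => ?; exact: cvg_cst. Qed.

Lemma within_measurable L f : {within half_line L, continuous f} ->
  measurable_fun (half_line L) f.
Proof.
by move=> cf; apply: subspace_continuous_measurable_fun => //.
Qed.

Lemma integrable_locint L f : mu.-integrable (half_line L) (EFin \o f) -> locint L f.
Proof.
move=> fi x; apply: integrableS fi => //.
exact: half_line_sub.
Qed.

Lemma within_integrableM f g (a b : R) : {within `[a, b], continuous f} ->
  mu.-integrable `[a, b] (EFin \o g) ->
  mu.-integrable `[a, b] (EFin \o (fun x => f x * g x)).
Proof.
move=> cf gi; apply: (@integrableMr _ _ _ mu _ _ f (EFin \o g)) => //.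
  by apply: subspace_continuous_measurable_fun.
have [M [Mr hM]] : bounded_set (f @` `[a, b]).
  by apply: compact_bounded; apply: continuous_compact => //; exact: segment_compact.
by exists M; split => // z Mz y yab; apply: (hM z Mz); exists y.
Qed.

Lemma locintM L F g : {within half_line L, continuous F} -> locint L g ->
  locint L (fun x => F x * g x).
Proof.
move=> cF gi x; apply: within_integrableM (gi x).
exact: (continuous_subspaceW (@half_line_sub L x)).
Qed.

Lemma locintD L f g : locint L f -> locint L g -> locint L (fun x => f x + g x).
Proof. by move=> fi gi x; have := integrableD _ (fi x) (gi x); exact. Qed.

Lemma locint_norm L f : locint L f -> locint L (fun x => `|f x|).
Proof. by move=> fi x; exact: integrable_norm. Qed.

(* Halving the increment of M by the intermediate value theorem gains a factor 2
   in the bound on the increment of K, so the bound improves to 2 ^ -n. *)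
Lemma quadratic_increment_cst L (M K : R -> R) :
  {within half_line L, continuous M} ->
  (forall y x, L <= y -> y <= x -> `|K x - K y| <= (M x - M y) ^+ 2) ->
  forall x, L <= x -> K x = K L.
Proof.
move=> cM hK.
have H n : forall y x, L <= y -> y <= x ->
    `|K x - K y| * 2 ^+ n <= (M x - M y) ^+ 2.
  elim: n => [y x Ly yx|n IH y x Ly yx]; first by rewrite mulr1; exact: hK.
  have cMyx : {within `[y, x], continuous M}.
    apply: continuous_subspaceW cM => z; rewrite /half_line/= !in_itv/= andbT => /andP[yz _].
    exact: le_trans yz.
  have [|c] := @IVT R M y x ((M x + M y) / 2) yx cMyx.
    by rewrite ge_min le_max; have [h|h] := leP (M x) (M y);
      apply/andP; split; apply/orP; [right|left|left|right]; lra.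
  rewrite in_itv/= => /andP[yc cx] Mc.
  have h1 := IH y c Ly yc; have h2 := IH c x (le_trans Ly yc) cx.
  have h3 : `|K x - K y| <= `|K x - K c| + `|K c - K y|.
    by apply: le_trans (ler_normD _ _); rewrite addrA subrK.
  rewrite exprS mulrCA.
  have : `|K x - K y| * 2 ^+ n <= (M c - M y) ^+ 2 + (M x - M c) ^+ 2.
    apply: le_trans (lerD h1 h2); rewrite -mulrDl.
    by rewrite ler_pM2r ?exprn_gt0 // [leRHS]addrC.
  by rewrite Mc; nra.
move=> x Lx; apply/eqP; rewrite -subr_eq0 -normr_eq0 eq_le normr_ge0 andbT.
rewrite leNgt; apply/negP => a0.
have [n hn] : exists n : nat, (M x - M L) ^+ 2 / `|K x - K L| < n%:R.
  exists (Num.bound ((M x - M L) ^+ 2 / `|K x - K L|)).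
  by apply: archi_boundP; rewrite divr_ge0// sqr_ge0.
have := H n L x (lexx _) Lx; rewrite leNgt => /negP; apply.
rewrite ltr_pdivrMr// in hn; rewrite (lt_trans hn)// mulrC ltr_pM2l//.
by rewrite -natrX ltr_nat ltn_expl.
Qed.

Lemma primitiveD L F f G g : primitive L F f -> primitive L G g ->
  primitive L (fun x => F x + G x) (fun x => f x + g x).
Proof.
move=> [fi Ff] [gi Gg]; split; first exact: locintD.
move=> x Lx; rewrite RintegralD// Ff// Gg//; ring.
Qed.

(** The defect [K] between the product and the integral of the expected density has increments of
    second order: over [[x, y]] they are at most [(M y - M x) ^+ 2], where [M] is the integral of
    [|f| + |g|]. Hence [K] is constant. *)
Lemma primitiveM L F f G g : primitive L F f -> primitive L G g ->
  primitive L (fun x => F x * G x) (fun x => f x * G x + F x * g x).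
Proof.
move=> pF pG.
have cF := primitive_continuous pF; have cG := primitive_continuous pG.
have [fi Ff] := pF; have [gi Gg] := pG.
have hi : locint L (fun x => f x * G x + F x * g x).
  apply: locintD; last exact: locintM.
  by under eq_fun do rewrite mulrC; exact: locintM.
split => //.
pose m x := `|f x| + `|g x|.
have mi : locint L m by apply: locintD; exact: locint_norm.
pose M x := \int[mu]_(t in `[L, x]) m t.
have pM : primitive L M m.
  by split => // x Lx; rewrite /M set_itv1 Rintegral_set1 add0r.
have absM f0 F0 y x : primitive L F0 f0 -> (forall t, `|f0 t| <= m t) ->
    L <= y -> y <= x -> `|F0 x - F0 y| <= M x - M y.
  move=> pF0 f0m Ly yx; rewrite (primitive_sub pF0 Ly yx) (primitive_sub pM Ly yx).
  have i0 := locint_sub x Ly pF0.1.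
  apply: le_trans (le_normr_Rintegral _ i0) _ => //.
  apply: le_Rintegral => //; first exact: integrable_norm.
  exact: (locint_sub x Ly mi).
have fm t : `|f t| <= m t by rewrite lerDl.
have gm t : `|g t| <= m t by rewrite lerDr.
pose K x := F x * G x - \int[mu]_(t in `[L, x]) (f t * G t + F t * g t).
suff KL x : L <= x -> K x = K L.
  move=> x Lx; have := KL x Lx; rewrite /K set_itv1 Rintegral_set1 subr0 => <-.
  by rewrite subrK.
apply: (quadratic_increment_cst (primitive_continuous pM)) => {}x y Lx xy.
have fi' := locint_sub y Lx fi; have gi' := locint_sub y Lx gi.
have hi' := locint_sub y Lx hi; have mi' := locint_sub y Lx mi.
have fGi : mu.-integrable `[x, y] (EFin \o (fun t => f t * G x)).
  by have := integrableZr _ (G x) fi'; exact.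
have Fgi : mu.-integrable `[x, y] (EFin \o (fun t => F y * g t)).
  by have := integrableZl _ (F y) gi'; exact.
have fgi : mu.-integrable `[x, y] (EFin \o (fun t => f t * G x + F y * g t)).
  by have := integrableD _ fGi Fgi; exact.
(* From [F y * G y - F x * G x = (F y - F x) * G x + F y * (G y - G x)]: each term freezes one
   factor at an endpoint. *)
have -> : K y - K x = \int[mu]_(t in `[x, y])
    (f t * G x + F y * g t - (f t * G t + F t * g t)).
  rewrite /K (Rintegral_split Lx xy (hi y)) (RintegralB _ fgi hi')// (RintegralD _ fGi Fgi)//.
  rewrite (RintegralZl _ _ gi')// (RintegralZr _ _ fi')// -(primitive_sub pF Lx xy).
  by rewrite -(primitive_sub pG Lx xy); ring.
set D := M y - M x.
have D0 : 0 <= D by apply: le_trans (absM f F _ _ pF fm Lx xy).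
rewrite expr2 {2}/D (primitive_sub pM Lx xy) -RintegralZl//.
have Ii : mu.-integrable `[x, y]
   (EFin \o (fun t => f t * G x + F y * g t - (f t * G t + F t * g t))).
  by have := integrableB _ fgi hi'; exact.
apply: le_trans (le_normr_Rintegral _ Ii) _ => //.
apply: le_Rintegral => //; first exact: integrable_norm.
  by have := integrableZl _ D mi'; exact.
move=> t; rewrite /= in_itv/= => /andP[xt ty].
have -> : f t * G x + F y * g t - (f t * G t + F t * g t) =
  - ((G t - G x) * f t) + (F y - F t) * g t by ring.
have Lt := le_trans Lx xt.
have Mm u v : L <= u -> u <= v -> M u <= M v.
  by move=> Lu uv; rewrite -subr_ge0 (le_trans _ (absM f F _ _ pF fm Lu uv)).
apply: le_trans (ler_normD _ _) _; rewrite normrN !normrM /m mulrDr.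
apply: lerD; apply: ler_wpM2r => //.
  by apply: le_trans (absM g G _ _ pG gm Lx xt) _; rewrite lerD2r Mm.
by apply: le_trans (absM f F _ _ pF fm Lt ty) _; rewrite lerD2l lerN2 Mm.
Qed.

End Primitives.

(** * Integrals over the whole half-line *)

Section HalfLineIntegrals.
Context {R : realType}.
Implicit Types (L x y z : R) (f g F G : R -> R).
Local Notation mu := (@lebesgue_measure R).

Lemma primitive_is_derive L F f : (forall x, is_derive x 1 F (f x)) ->
  continuous f -> primitive L F f.
Proof.
move=> dF cf.
have cF : continuous F.
  by move=> x; apply: differentiable_continuous; apply/derivable1_diffP; case: (dF x).
split; first by apply: within_locint; exact: continuous_subspaceT.
move=> x; rewrite le_eqVlt => /predU1P[<-|Lx].
  by rewrite set_itv1 Rintegral_set1 addr0.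
rewrite /Rintegral (@continuous_FTC2 _ f F L x Lx).
- by rewrite /=; ring.
- exact: continuous_subspaceT.
- split.
  + by move=> y _; case: (dF y).
  + exact/cvg_at_right_filter/cF.
  + exact/cvg_at_left_filter/cF.
- by move=> y _; rewrite derive1E; exact: derive_val.
Qed.

Lemma half_line_bigcup L : half_line L = \bigcup_k `[L, L + k%:R]%classic.
Proof. by rewrite /half_line itv_bndy_bigcup_BRight. Qed.

Lemma locint_measurable L f : locint L f -> measurable_fun (half_line L) f.
Proof.
move=> fi; rewrite half_line_bigcup; apply/measurable_fun_bigcup => // n.
by apply/measurable_EFinP; exact: (measurable_int mu (fi _)).
Qed.

Lemma ge0_half_line_cvg L f : measurable_fun (half_line L) f ->
  (forall x, L <= x -> 0 <= f x) ->
  (\int[mu]_(x in `[L, (L + n%:R)%R]) (f x)%:E @[n --> \oo] -->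
   \int[mu]_(x in half_line L) (f x)%:E)%E.
Proof.
move=> mf f0; rewrite half_line_bigcup.
apply: ge0_nondecreasing_set_cvg_integral => //.
- move=> m n mn; apply/subsetPset; apply: subset_itvl.
  by rewrite bnd_simp lerD2l ler_nat.
- move=> n; apply/measurable_EFinP; apply: measurable_funS mf => //.
  exact: half_line_sub.
- by move=> n x /=; rewrite in_itv/= => /andP[/f0].
Qed.

(** By monotone convergence along [[L, L + n]], where the integrals are
    [F (L + n) - F L <= C - F L]. *)
Lemma primitive_bounded_integrable L F f (C : R) : primitive L F f ->
  (forall x, L <= x -> 0 <= f x) -> (forall x, L <= x -> F x <= C) ->
  mu.-integrable (half_line L) (EFin \o f).
Proof.
move=> [fi Ff] f0 FC; apply/integrableP; split.
  by apply/measurable_EFinP; exact: locint_measurable.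
apply: (@le_lt_trans _ _ (C - F L)%:E); last exact: ltry.
have -> : (\int[mu]_(x in half_line L) `|(EFin \o f) x| =
    \int[mu]_(x in half_line L) (f x)%:E)%E.
  by apply: eq_integral => x; rewrite inE half_lineE => /f0 ?; rewrite /= ger0_norm.
have mf := locint_measurable fi.
rewrite -(cvg_lim _ (ge0_half_line_cvg mf f0))//.
apply: lime_le.
  by apply/cvg_ex; eexists; exact: (ge0_half_line_cvg mf f0).
apply: nearW => n.
have Ln : L <= L + n%:R by rewrite lerDl.
rewrite -[leLHS]fineK; last exact: (integrable_fin_num _ (fi _)).
by have := FC _ Ln; rewrite Ff// lee_fin lerBrDl.
Qed.

(** The tail of [f] beyond [x] is dominated by the tail of [|f|], which decreases in [x] and tends
    to 0 along [L + n] by monotone convergence. *)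
Lemma Rintegral_half_line_cvg L f : mu.-integrable (half_line L) (EFin \o f) ->
  (\int[mu]_(t in `[L, x]) f t) @[x --> +oo] --> \int[mu]_(t in half_line L) f t.
Proof.
move=> fi.
have ni := integrable_norm fi.
have mn : measurable_fun (half_line L) (fun x => `|f x|).
  by apply/measurable_EFinP; exact: (measurable_int mu ni).
have lni := integrable_locint ni.
have c : (\int[mu]_(t in `[L, L + n%:R]) `|f t|) @[n --> \oo] -->
   \int[mu]_(t in half_line L) `|f t|.
  apply: fine_cvg; rewrite fineK; last by apply: integrable_fin_num => //.
  by apply: ge0_half_line_cvg.
have tail f0 x : mu.-integrable (half_line L) (EFin \o f0) -> L <= x ->
    \int[mu]_(t in half_line L) f0 t - \int[mu]_(t in `[L, x]) f0 t =
    \int[mu]_(t in `]x, +oo[) f0 t.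
  by move=> f0i Lx; apply: Rintegral_itvB => //; rewrite bnd_simp.
apply/cvgrPdist_le => e e0.
move/cvgrPdist_le : c => /(_ e e0)[n _ hn].
near=> x.
have nx : L + n%:R <= x by near: x; apply: nbhs_pinfty_ge; exact: num_real.
have Lx : L <= x by apply: le_trans nx; rewrite lerDl.
have sx : `]x, +oo[ `<=` half_line L.
  by apply: subset_itvr; rewrite bnd_simp.
rewrite tail//.
have xi : mu.-integrable `]x, +oo[ (EFin \o f) by exact: integrableS fi.
apply: le_trans (le_normr_Rintegral _ xi) _ => //.
rewrite -tail//; apply: le_trans (hn n (leqnn n)).
apply: le_trans (ler_norm _); rewrite lerD2l lerN2.
rewrite (Rintegral_split _ nx (lni _)) ?lerDl//.
by apply: Rintegral_ge0 => t _ /=.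
Unshelve. all: by end_near. Qed.

(** Integrability of [f] gives [F] a limit at infinity, and integrability of [F] forces this limit
    to be 0, so only the endpoint [L] contributes. *)
Lemma FTC_half_line L F f : primitive L F f ->
  mu.-integrable (half_line L) (EFin \o f) ->
  mu.-integrable (half_line L) (EFin \o F) ->
  \int[mu]_(t in half_line L) f t = - F L.
Proof.
move=> pF fi Fi; set I := \int[mu]_(t in _) f t.
have cF : F x @[x --> +oo] --> F L + I.
  have c : (F L + \int[mu]_(t in `[L, x]) f t) @[x --> +oo] --> F L + I.
    by apply: cvgD; [exact: cvg_cst|exact: Rintegral_half_line_cvg].
  apply: cvg_trans c; apply: near_eq_cvg; near=> x.
  have Lx : L <= x by near: x; apply: nbhs_pinfty_ge; exact: num_real.
  by rewrite -pF.2.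
suff : F L + I = 0 by move/eqP; rewrite addrC addr_eq0 => /eqP.
apply/eqP; rewrite -normr_eq0 eq_le normr_ge0 andbT leNgt; apply/negP => l0.
have ni := integrable_norm Fi.
have c := Rintegral_half_line_cvg ni.
set l := `|F L + I| in l0.
have l4 : 0 < l / 4 by rewrite divr_gt0.
move/cvgrPdist_le : c => /(_ _ l4)[M1 [_ h1]].
move/cvgrPdist_le : cF => /(_ _ l4)[M2 [_ h2]].
pose x := `|L| + `|M1| + `|M2| + 1.
have xM : [/\ L < x, M1 < x & M2 < x].
  have := ler_norm L; have := ler_norm M1; have := ler_norm M2.
  have := normr_ge0 L; have := normr_ge0 M1; have := normr_ge0 M2.
  by rewrite /x; split; lra.
have [Lx M1x M2x] := xM.
have xx1 : x <= x + 1 by rewrite lerDl.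
have := h1 _ M1x; have := h1 (x + 1) (lt_le_trans M1x xx1).
rewrite (Rintegral_split (ltW Lx) xx1 (integrable_locint ni _)).
set I1 := \int[mu]_(t in _) _; set I2 := \int[mu]_(t in `[L, x]) _.
set I3 := \int[mu]_(t in _) _ => k1 k2.
(* Far out [|F|] stays above [3 / 4 * l], whereas the integrals of [|F|] up to [x] and up to [x + 1]
   both lie within [l / 4] of the full one, which leaves at most [l / 2] for [[x, x + 1]]. *)
have : 3 / 4 * l <= I3.
  have -> : 3 / 4 * l = \int[mu]_(t in `[x, x + 1]) (3 / 4 * l).
    rewrite Rintegral_cst//= lebesgue_measure_itv/= lte_fin ltrDl ltr01.
    by rewrite -EFinD addrAC subrr add0r mulr1.
  apply: le_Rintegral => //.
  - apply: continuous_compact_integrable; first exact: segment_compact.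
    by apply: continuous_subspaceT => ?; exact: cvg_cst.
  - exact: locint_sub (ltW Lx) (integrable_locint ni).
  - move=> t /=; rewrite in_itv/= => /andP[xt _].
    have := h2 _ (lt_le_trans M2x xt).
    have : l <= `|F L + I - F t| + `|F t|.
      by apply: le_trans (ler_normD _ _); rewrite subrK.
    lra.
move: k1 k2; rewrite !ler_norml => /andP[? ?] /andP[? ?]; lra.
Unshelve. all: by end_near. Qed.

End HalfLineIntegrals.

(** * Almost-everywhere equality and square-integrable functions *)

Section AlmostEverywhere.
Context {R : realType}.
Implicit Types (L x y z : R) (f g F G : R -> R).
Local Notation mu := (@lebesgue_measure R).

Lemma ae_half_lineS L (P Q : R -> Prop) : (forall x, L <= x -> P x -> Q x) ->
  (\forall x \ae mu, half_line L x -> P x) -> \forall x \ae mu, half_line L x -> Q x.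
Proof.
move=> PQ; apply: (@filterS _ _ (ae_filter_ringOfSetsType mu)) => x Px Dx; apply: PQ; first by rewrite half_lineE in Dx.
exact: Px.
Qed.

Lemma ae_half_lineI L (P Q S : R -> Prop) :
  (forall x, L <= x -> P x -> Q x -> S x) ->
  (\forall x \ae mu, half_line L x -> P x) ->
  (\forall x \ae mu, half_line L x -> Q x) -> \forall x \ae mu, half_line L x -> S x.
Proof.
move=> PQ; apply: (@filterS2 _ _ (ae_filter_ringOfSetsType mu)) => x Px Qx Dx; apply: PQ; [|exact: Px|exact: Qx].
by rewrite half_lineE in Dx.
Qed.

Lemma ae_neq L : \forall x \ae mu, x != L.
Proof.
exists [set L]; split => [||x /=]; first exact: measurable_set1.
  exact: lebesgue_measure_set1.
by move/negP; rewrite negbK => /eqP.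
Qed.

Lemma ae_eq_continuous L f g : {within half_line L, continuous f} ->
  {within half_line L, continuous g} -> f = g %[ae mu in half_line L] ->
  forall x, L <= x -> f x = g x.
Proof.
move=> cf cg fg x Lx; apply/eqP; rewrite -subr_eq0; apply/negP => /negP h0.
have ch : {within half_line L, continuous (fun y => f y - g y)}.
  by move=> y; apply: (@cvgB _ R^o); [exact: cf|exact: cg].
move/subspace_continuousP : ch => /(_ x); rewrite half_lineE => /(_ Lx).
have h1 : 0 < `|f x - g x| by rewrite normr_gt0.
move/cvgrPdist_lt => /(_ _ h1) [e /= e0 he].
(* Only points to the right of [x] are used, so that the argument also covers the endpoint
   [x = L]. *)
have : mu.-negligible `[x, x + e / 2].
  case: fg => N [mN N0 sN]; exists N; split => // y.
  rewrite /= in_itv/= => /andP[xy ye]; apply: sN => /= h.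
  have Dy : half_line L y by rewrite half_lineE (le_trans Lx).
  have bxy : ball_ Num.norm x e y.
    by rewrite /ball_/= distrC ger0_norm ?subr_ge0// ltrBlDl (le_lt_trans ye)// ltrD2l; lra.
  by have := he y bxy Dy; rewrite /from_subspace (h Dy) subrr subr0 ltxx.
move/(negligibleP mu (measurable_itv _)) => /=.
rewrite lebesgue_measure_itv/= lte_fin ltrDl divr_gt0// -EFinB.
by move=> [] /eqP; rewrite addrAC subrr add0r gt_eqF// divr_gt0.
Qed.

Lemma ae_eq_Rintegral L f g : f = g %[ae mu in half_line L] ->
  measurable_fun (half_line L) f -> measurable_fun (half_line L) g ->
  \int[mu]_(x in half_line L) f x = \int[mu]_(x in half_line L) g x.
Proof.
move=> fg mf mg; congr fine; apply: ae_eq_integral => //; try exact/measurable_EFinP.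
by apply: ae_half_lineS fg => x _ ->.
Qed.

Lemma ae_eq_integrable L f g : f = g %[ae mu in half_line L] ->
  measurable_fun (half_line L) g -> mu.-integrable (half_line L) (EFin \o f) ->
  mu.-integrable (half_line L) (EFin \o g).
Proof.
move=> fg mg /integrableP[mf fi]; apply/integrableP; split; first exact/measurable_EFinP.
rewrite -(@ae_eq_integral _ _ _ mu _ _ (fun x => `|(f x)%:E|)%E)//.
- by apply/measurableT_comp.
- by apply/measurableT_comp => //; exact/measurable_EFinP.
- by apply: ae_half_lineS fg => x _ /= ->.
Qed.

(** Extension by zero gives a function on the whole line, the setting of Lebesgue
    differentiation. *)
Lemma locint_locally L f : locint L f ->
  locally_integrable setT (f \_ (half_line L)).
Proof.
move=> fi; have mf := locint_measurable fi; split.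
- by apply/(measurable_restrictT f) => //.
- exact: openT.
- move=> K _ cK.
  have mK : measurable K by exact: compact_measurable.
  have [M [_ hM]] := compact_bounded cK.
  have KM x : K x -> x <= M + 1.
    move=> Kx; apply: le_trans (ler_norm _) _; apply: (hM (M + 1)) => //.
    by rewrite ltrDl.
  have /integrableP[_] := fi (M + 1).
  apply: le_lt_trans.
  have -> : (\int[mu]_(x in K) `|(f \_ (half_line L)) x|%:E =
      \int[mu]_(x in K `&` half_line L) `|(EFin \o f) x|)%E.
    rewrite integral_mkcondr; apply: eq_integral => x _.
    by rewrite /= !patchE; case: ifP => //; rewrite normr0.
  apply: ge0_subset_integral => //; first exact: measurableI.
    by do 2 apply: measurableT_comp => //; apply: measurable_funS mf => //; exact: half_line_sub.
  move=> x [Kx]; rewrite half_lineE => Lx.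
  by rewrite /= in_itv/= Lx KM.
Qed.

(** By Lebesgue differentiation the density is a.e. the derivative of its indefinite integral, here
    identically 0. The differentiation theorem speaks of points strictly beyond [L]; the point [L]
    itself is a null set. *)
Lemma primitive_cst_ae0 L F f : primitive L F f ->
  (forall x, L <= x -> F x = F L) -> f = (fun=> 0) %[ae mu in half_line L].
Proof.
move=> [fi Ff] FL; set f0 := f \_ (half_line L).
have int0 y : \int[mu]_(t in `[L, y]) f0 t = 0.
  transitivity (\int[mu]_(t in `[L, y]) f t).
    apply: eq_Rintegral => t; rewrite inE => /half_line_sub Dt.
    by rewrite /f0 patchE mem_set.
  have [Ly|yL] := leP L y.
    by have := Ff y Ly; rewrite (FL y Ly) -[LHS]addr0 => /addrI <-.
  by rewrite set_itv_ge ?Rintegral_set0// bnd_simp -ltNge.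
have fi0 y : mu.-integrable `[L, y] (EFin \o f0).
  apply: eq_integrable (fi y) => // t; rewrite inE => /half_line_sub Dt.
  by rewrite /= /f0 patchE mem_set.
have := @FTC1 R f0 (BLeft L) fi0 (locint_locally fi).
apply: (@filterS2 _ _ (ae_filter_ringOfSetsType mu) _ _ _ _ (ae_neq L)) => x xL /= + Dx.
rewrite half_lineE in Dx.
rewrite lte_fin lt_neqAle eq_sym xL Dx => /(_ isT)[_]; rewrite derive1E.
under eq_fun do rewrite int0.
by rewrite derive_cst => e; rewrite e /f0 patchE mem_set// half_lineE.
Qed.

Lemma integrable_supp L f (b : R) : locint L f -> (forall x, b < x -> f x = 0) ->
  mu.-integrable (half_line L) (EFin \o f).
Proof.
move=> fi f0.
apply: (@eq_integrable _ _ _ mu _ _ ((EFin \o f) \_ `[L, b])) => //.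
  move=> x; rewrite inE half_lineE => Lx; rewrite patchE; case: ifPn => //.
  by rewrite notin_setE/= in_itv/= Lx/= => /negP; rewrite -ltNge => /f0 ->.
apply/(integrable_restrict) => //.
by apply: integrableS (fi b) => //; exact: measurableI.
Qed.

Lemma integrable_halfD L f g : mu.-integrable (half_line L) (EFin \o f) ->
  mu.-integrable (half_line L) (EFin \o g) ->
  mu.-integrable (half_line L) (EFin \o (fun x => f x + g x)).
Proof. by move=> fi gi; have := integrableD _ fi gi; exact. Qed.

Lemma integrable_halfZ L (k : R) f : mu.-integrable (half_line L) (EFin \o f) ->
  mu.-integrable (half_line L) (EFin \o (fun x => k * f x)).
Proof. by move=> fi; have := integrableZl _ k fi; exact. Qed.

Lemma L2_mul L f g : L2_real L f -> L2_real L g ->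
  mu.-integrable (half_line L) (EFin \o (fun x => f x * g x)).
Proof.
move=> [mf fi] [mg gi]; have h := integrable_halfD fi gi.
apply: le_integrable h => //; first by apply/measurable_EFinP; exact: measurable_funM.
move=> x _; rewrite /= lee_fin [leRHS]ger0_norm ?addr_ge0 ?sqr_ge0// normrM.
by rewrite -(real_normK (num_real (f x))) -(real_normK (num_real (g x))); nra.
Qed.

Lemma L2_locint L f : L2_real L f -> locint L f.
Proof.
move=> [mf fi] x.
(* The bound is [|f| <= f ^+ 2 + 1]; the constant is integrable because the interval is bounded. *)
have c1 : mu.-integrable `[L, x] (EFin \o (fun=> 1)).
  apply: continuous_compact_integrable; first exact: segment_compact.
  by apply: continuous_subspaceT => ?; exact: cvg_cst.
have := integrableD _ (integrable_locint fi x) c1 => /(_ (measurable_itv _)) h.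
apply: le_integrable h => //.
  apply/measurable_EFinP; apply: measurable_funS mf => //; exact: half_line_sub.
move=> y _; rewrite /= lee_fin [leRHS]ger0_norm ?addr_ge0 ?sqr_ge0//.
by rewrite -(real_normK (num_real (f y))); nra.
Qed.

Lemma L2D L f g : L2_real L f -> L2_real L g -> L2_real L (fun x => f x + g x).
Proof.
move=> f2 g2; have [mf fi] := f2; have [mg gi] := g2.
split; first exact: measurable_funD.
have fg := L2_mul f2 g2.
have h := integrable_halfD (integrable_halfD fg fg) (integrable_halfD fi gi).
by apply: eq_integrable h => // x _; rewrite /=; congr EFin; ring.
Qed.

Lemma L2_bounded_mul L f g (M : R) : L2_real L f -> measurable_fun (half_line L) g ->
  (forall x, L <= x -> `|g x| <= M) -> L2_real L (fun x => g x * f x).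
Proof.
move=> [mf fi] mg gM; split; first exact: measurable_funM.
have h := integrable_halfZ (M ^+ 2) fi.
apply: le_integrable h => //.
  by apply/measurable_EFinP; apply: measurable_funX; exact: measurable_funM.
move=> x; rewrite half_lineE => Lx; rewrite /= lee_fin.
rewrite [leLHS]ger0_norm ?sqr_ge0// [leRHS]ger0_norm; last first.
  by apply: mulr_ge0; exact: sqr_ge0.
rewrite exprMn ler_wpM2r ?sqr_ge0//.
rewrite -(real_normK (num_real (g x))) ler_pXn2r ?nnegrE//; first exact: gM.
by apply: le_trans (gM _ Lx).
Qed.

Lemma L2_ae L f g : f = g %[ae mu in half_line L] ->
  measurable_fun (half_line L) g -> L2_real L f -> L2_real L g.
Proof.
move=> fg mg [mf fi]; split => //.
apply: (@ae_eq_integrable L (fun x => f x ^+ 2)) => //; last exact: measurable_funX.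
by apply: ae_half_lineS fg => x _ ->.
Qed.

End AlmostEverywhere.

(** * Du Bois-Reymond lemma and weak derivatives *)

Section Bump.
Context {R : realType}.
Implicit Types s x e : R.

Definition posp (s : R) := Num.max s 0.
(* Second differences of the C^1 function posp ^ 2 / 2 give a C^1 step, whose
   derivative is the tent. *)
Definition tent (s : R) := posp (s + 1) - 2 * posp s + posp (s - 1).
Definition step (s : R) :=
  (posp (s + 1) ^+ 2 - 2 * posp s ^+ 2 + posp (s - 1) ^+ 2) / 2.

Lemma pospP s : (0 <= s /\ posp s = s) \/ (s <= 0 /\ posp s = 0).
Proof. by rewrite /posp; case: (leP s 0) => h; [right|left; rewrite ltW]. Qed.

(** [posp] has a kink at 0, so the difference quotient is estimated directly: the first-order
    remainder is at most [h ^+ 2] for all signs of [s] and [h + s]. *)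
Lemma is_derive_posp2 s : is_derive s 1 (fun t => posp t ^+ 2) (2 * posp s).
Proof.
suff h : h^-1 *: (posp (h *: 1 + s) ^+ 2 - posp s ^+ 2) @[h --> 0^'] --> (2 * posp s : R).
  apply: DeriveDef; first by apply/cvg_ex; exists (2 * posp s).
  by apply/cvg_lim.
apply/cvgrPdist_le => e e0; near=> h.
have h0 : h != 0 by near: h; exact: nbhs_dnbhs_neq.
have he : `|h| <= e by near: h; apply: dnbhs0_le.
rewrite /GRing.scale/= mulr1.
have -> : 2 * posp s - h^-1 * (posp (h + s) ^+ 2 - posp s ^+ 2) =
   h^-1 * (2 * posp s * h - (posp (h + s) ^+ 2 - posp s ^+ 2)) by field.
rewrite normrM normfV mulrC ler_pdivrMr ?normr_gt0//.
apply: (@le_trans _ _ (h ^+ 2)); last first.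
  by rewrite -(real_normK (num_real h)) expr2 ler_wpM2r.
have [[a ->]|[a ->]] := pospP s; have [[b ->]|[b ->]] := pospP (h + s);
  rewrite ler_norml; apply/andP; split; nra.
Unshelve. all: by end_near. Qed.

Lemma continuous_posp : continuous posp.
Proof.
have -> : posp = fun s => (s + `|s|) / 2.
  apply/funext => s; have [[s0 ->]|[s0 ->]] := pospP s.
    by rewrite ger0_norm//; field.
  by rewrite ler0_norm// subrr mul0r.
move=> x; apply: cvgMl; apply: (@cvgD _ R^o); first exact: cvg_id.
exact: norm_continuous.
Qed.

Lemma tent_bound s : 0 <= tent s <= 1.
Proof.
rewrite /tent; have [[a ->]|[a ->]] := pospP s; have [[b ->]|[b ->]] := pospP (s + 1);
have [[c ->]|[c ->]] := pospP (s - 1); lra.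
Qed.

Lemma tent_out s : 1 <= `|s| -> tent s = 0.
Proof.
rewrite /tent ler_normr => /orP h; have [[a ->]|[a ->]] := pospP s;
have [[b ->]|[b ->]] := pospP (s + 1); have [[c ->]|[c ->]] := pospP (s - 1);
case: h => ?; lra.
Qed.

Lemma step_left s : s <= -1 -> step s = 0.
Proof.
rewrite /step => h; have [[a ->]|[a ->]] := pospP s;
have [[b ->]|[b ->]] := pospP (s + 1); have [[c ->]|[c ->]] := pospP (s - 1);
try nra.
Qed.

Lemma step_right s : 1 <= s -> step s = 1.
Proof.
rewrite /step => h; have [[a ->]|[a ->]] := pospP s;
have [[b ->]|[b ->]] := pospP (s + 1); have [[c ->]|[c ->]] := pospP (s - 1);
try nra.
Qed.

(** The outer division by [e] gives this bump mass 1: it is an approximate identity at [x] as [e]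
    tends to 0, and the derivative of [step_at x e]. *)
Definition tent_at x e s := tent ((s - x) / e) / e.
Definition step_at x e s := step ((s - x) / e).

Lemma is_derive_posp2_affine (a b s : R) :
  is_derive s 1 (fun t => posp (a * t + b) ^+ 2) (2 * a * posp (a * s + b)).
Proof.
have h := is_derive_posp2 (a * s + b).
have h2 : is_derive s 1 (fun t => a * t + b) a.
  apply: is_derive_eq; rewrite /GRing.scale/=; ring.
have := @is_derive1_comp _ (fun t => posp t ^+ 2) (fun t => a * t + b) s _ _ h h2.
by rewrite /comp => k; apply: is_derive_eq k _; ring.
Qed.

Lemma is_derive_step_at x e s : e != 0 -> is_derive s 1 (step_at x e) (tent_at x e s).
Proof.
move=> e0.
have h1 := is_derive_posp2_affine e^-1 (1 - x / e) s.
have h2 := is_derive_posp2_affine e^-1 (- x / e) s.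
have h3 := is_derive_posp2_affine e^-1 (- 1 - x / e) s.
have -> : step_at x e = fun t => 2^-1 * (posp (e^-1 * t + (1 - x / e)) ^+ 2 +
  ((- 2) * posp (e^-1 * t + (- x / e)) ^+ 2 + posp (e^-1 * t + (- 1 - x / e)) ^+ 2)).
  apply/funext => t; rewrite /step_at /step.
  have -> : (t - x) / e + 1 = e^-1 * t + (1 - x / e) by field.
  have -> : (t - x) / e - 1 = e^-1 * t + (-1 - x / e) by field.
  have -> : (t - x) / e = e^-1 * t + (- x / e) by field.
  by field.
have h4 := is_deriveZ 2^-1 (is_deriveD h1 (is_deriveD (is_deriveZ (- 2) h2) h3)).
refine (is_derive_eq h4 _); rewrite /GRing.scale/= /tent_at /tent.
have -> : (s - x) / e + 1 = e^-1 * s + (1 - x / e) by field.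
have -> : (s - x) / e - 1 = e^-1 * s + (-1 - x / e) by field.
have -> : (s - x) / e = e^-1 * s + (- x / e) by field.
by field.
Qed.

Lemma continuous_tent_at x e : continuous (tent_at x e).
Proof.
have ct : continuous tent.
  move=> s; apply: (@cvgD _ R^o); first apply: (@cvgB _ R^o).
  - apply: continuous_cvg; first exact: continuous_posp.
    by apply: (@cvgD _ R^o); [exact: cvg_id|exact: cvg_cst].
  - by apply: cvgMr; exact: continuous_posp.
  - apply: continuous_cvg; first exact: continuous_posp.
    by apply: (@cvgB _ R^o); [exact: cvg_id|exact: cvg_cst].
move=> s; rewrite /tent_at; apply: cvgMl.
apply: continuous_cvg; first exact: ct.
by apply: cvgMl; apply: (@cvgB _ R^o); [exact: cvg_id|exact: cvg_cst].
Qed.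

End Bump.

Section RealWeakDerivatives.
Context {R : realType}.
Implicit Types (L x y z e : R) (f g u F G phi : R -> R).
Local Notation mu := (@lebesgue_measure R).

Lemma tent_at_out x e s : 0 < e -> e <= `|s - x| -> tent_at x e s = 0.
Proof.
move=> e0 h; rewrite /tent_at tent_out ?mul0r// normrM normfV (gtr0_norm e0).
by rewrite ler_pdivlMr// mul1r.
Qed.

Lemma tent_at_bound x e s : 0 < e -> 0 <= tent_at x e s <= e^-1.
Proof.
move=> e0; have /andP[h1 h2] := tent_bound ((s - x) / e).
by rewrite /tent_at divr_ge0 ?(ltW e0)//= -[leRHS]mul1r ler_wpM2r// invr_ge0 ltW.
Qed.

Lemma step_at_left x e s : 0 < e -> s <= x - e -> step_at x e s = 0.
Proof. by move=> e0 h; rewrite /step_at step_left// ler_pdivrMr//; lra. Qed.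

Lemma step_at_right x e s : 0 < e -> x + e <= s -> step_at x e s = 1.
Proof. by move=> e0 h; rewrite /step_at step_right// ler_pdivlMr//; lra. Qed.

Lemma derive1_stepB x y e : e != 0 ->
  derive1 (fun s => step_at x e s - step_at y e s) =
  fun s => tent_at x e s - tent_at y e s.
Proof.
move=> e0; apply/funext => s; rewrite derive1E.
have h1 := is_derive_step_at x s e0; have h2 := is_derive_step_at y s e0.
have h := is_deriveB h1 h2; exact: (@derive_val _ _ _ _ _ _ _ h).
Qed.

(** A single step remains equal to 1 on the right; subtracting a second one makes the support
    compact. *)
Lemma test_stepB L x y e : 0 < e -> L < x - e -> L < y - e ->
  test_function L (fun s => step_at x e s - step_at y e s).
Proof.
move=> e0 Lx Ly; have en0 : e != 0 by rewrite gt_eqF.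
split.
- move=> s; have h1 := is_derive_step_at x s en0; have h2 := is_derive_step_at y s en0.
  by case: (is_deriveB h1 h2).
- rewrite derive1_stepB// => s; apply: (@cvgB _ R^o); exact: continuous_tent_at.
- exists (Num.min (x - e) (y - e)), (Num.max (x + e) (y + e)); split.
    by rewrite lt_min Lx.
  move=> s; rewrite in_itv/= negb_and -!ltNge lt_min gt_max => /orP[|] /andP[? ?].
    by rewrite !step_at_left ?subrr// ltW.
  by rewrite !step_at_right ?subrr// ltW.
Qed.

Lemma continuous_within_half L f : continuous f -> {within half_line L, continuous f}.
Proof. exact: continuous_subspaceT. Qed.

Lemma Rintegral_tent L x e : 0 < e -> L < x - e ->
  \int[mu]_(s in half_line L) tent_at x e s = 1.
Proof.
move=> e0 Lx; have en0 : e != 0 by rewrite gt_eqF.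
(* Lowered by 1, the step vanishes beyond [x + e], hence is integrable as [FTC_half_line] requires,
   and it equals -1 at [L]. *)
have d (s : R) : is_derive s 1 (fun s => step_at x e s - 1) (tent_at x e s).
  have h := is_deriveB (is_derive_step_at x s en0) (is_derive_cst _ _ _ : is_derive s 1 (fun=> 1 : R) (0 : R)).
  by apply: (is_derive_eq h); rewrite subr0.
have pS := @primitive_is_derive _ L _ _ d (@continuous_tent_at _ x e).
have := FTC_half_line pS.
rewrite step_at_left//; last exact: ltW.
rewrite sub0r opprK; apply.
  apply: (@integrable_supp _ _ _ (x + e) pS.1) => s xs; apply: tent_at_out => //.
  by apply: le_trans (ler_norm _); lra.
apply: (@integrable_supp _ _ _ (x + e)); first exact: within_locint (primitive_continuous pS).
by move=> s xs; rewrite step_at_right ?subrr// ltW.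
Qed.

Lemma integrable_mul_tent L u x e : 0 < e -> locint L u ->
  mu.-integrable (half_line L) (EFin \o (fun s => u s * tent_at x e s)).
Proof.
move=> e0 ui; apply: (@integrable_supp _ _ _ (x + e)).
  under eq_fun do rewrite mulrC.
  by apply: locintM => //; apply: continuous_within_half; exact: continuous_tent_at.
move=> s xs; rewrite tent_at_out ?mulr0//; apply: le_trans (ler_norm _); lra.
Qed.

(** The kernel is at most [e^-1] on a ball of measure [2 * e], whence the factor 2 in front of the
    mean deviation [davg], the quantity that tends to 0 at a Lebesgue point. *)
Lemma tent_average L u x e : 0 < e -> L < x - e -> locint L u ->
  (`|\int[mu]_(s in half_line L) (u s * tent_at x e s) - u x|%:E <=
  2%:E * davg (u \_ (half_line L)) x e)%E.
Proof.
move=> e0 Lx ui; set u0 := u \_ (half_line L).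
have cint := locint_cst L (u x).
have -> : \int[mu]_(s in half_line L) (u s * tent_at x e s) - u x =
   \int[mu]_(s in half_line L) ((u s - u x) * tent_at x e s).
  transitivity (\int[mu]_(s in half_line L) (u s * tent_at x e s - u x * tent_at x e s)).
    rewrite RintegralB//; [|exact: integrable_mul_tent|exact: integrable_mul_tent].
    congr (_ - _); rewrite RintegralZl// ?Rintegral_tent ?mulr1//.
    apply: eq_integrable (integrable_mul_tent x e0 (locint_cst L 1)) => // s _.
    by rewrite /= mul1r.
  by apply: eq_Rintegral => s _; rewrite mulrBl.
have di : mu.-integrable (half_line L) (EFin \o (fun s => (u s - u x) * tent_at x e s)).
  apply: integrable_mul_tent => //.
  by have := fun z => integrableB _ (ui z) (cint z); apply.
rewrite EFin_normr_Rintegral//.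
have md := measurable_int _ di.
apply: le_trans (le_abse_integral _ _ md) _ => //.
have bD : ball x e `<=` half_line L.
  move=> s; rewrite /ball/= half_lineE => xs; have := ler_norm (x - s); lra.
have mb : measurable (ball x e) by exact: measurable_ball.
have mu0 : measurable_fun setT u0 by apply/(measurable_restrictT u) => //; exact: locint_measurable.
pose h s := (e^-1%:E * `|(u0 s - u0 x)%:E|)%E.
have mh : measurable_fun setT h.
  apply: measurable_funeM; apply: measurableT_comp => //; apply/measurable_EFinP.
  exact: measurable_funB.
apply: (@le_trans _ _ (\int[mu]_(s in half_line L) (h \_ (ball x e)) s)%E).
  apply: ge0_le_integral => //.
  - by apply: measurableT_comp.
  - by apply: measurable_funTS; apply/(measurable_restrictT h) => //; apply: measurable_funTS.
  - move=> s; rewrite half_lineE => Ls; rewrite patchE; case: ifPn => sb.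
      rewrite /h -EFinM lee_fin /= normrM mulrC.
      have /andP[t0 t1] := tent_at_bound x s e0.
      rewrite (ger0_norm t0) /u0 !patchE !mem_set ?half_lineE//; last lra.
      exact: ler_wpM2r.
    rewrite /= tent_at_out ?mulr0 ?normr0// leNgt; apply/negP => xs.
    by move/negP: sb; apply; rewrite inE/= /ball/= distrC.
rewrite -integral_mkcondr setIidr//.
rewrite ge0_integralZl//; last 2 first.
  by apply: measurableT_comp => //; apply/measurable_EFinP; apply: measurable_funTS; exact: measurable_funB.
  by rewrite lee_fin invr_ge0 ltW.
rewrite /davg /iavg lebesgue_measure_ball ?(ltW e0)// muleA.
rewrite inver ?mulrn_eq0/= gt_eqF//= -EFinM.
have -> : 2 / (e *+ 2) = e^-1 by rewrite -mulr_natr; field; rewrite gt_eqF.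
exact: lexx.
Qed.

(* Testing with a difference of two tents shows that u has the same tent averages
   near any two points; these averages tend to u at the Lebesgue points. *)
Lemma du_bois_reymond L u : locint L u ->
  (forall phi, test_function L phi ->
     \int[mu]_(s in half_line L) (u s * derive1 phi s) = 0) ->
  exists c, u = (fun=> c) %[ae mu in half_line L].
Proof.
move=> ui hu.
have eqt x y e : 0 < e -> L < x - e -> L < y - e ->
   \int[mu]_(s in half_line L) (u s * tent_at x e s) =
   \int[mu]_(s in half_line L) (u s * tent_at y e s).
  move=> e0 Lx Ly; have := hu _ (test_stepB e0 Lx Ly).
  rewrite derive1_stepB ?gt_eqF//; under eq_Rintegral do rewrite mulrBr.
  rewrite RintegralB//; [|exact: integrable_mul_tent|exact: integrable_mul_tent].
  by move/eqP; rewrite subr_eq0 => /eqP.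
set u0 := u \_ (half_line L).
have eqL x y : L < x -> L < y -> lebesgue_pt u0 x -> lebesgue_pt u0 y -> u x = u y.
  move=> Lx Ly /fine_cvgP[fx cx] /fine_cvgP[fy cy].
  apply/eqP; rewrite -subr_eq0 -normr_eq0 eq_le normr_ge0 andbT.
  apply/ler_addgt0Pl => e e0; rewrite addr0.
  (* Each of the two points costs twice its mean deviation, that is, less than [e / 2]. *)
  have e4 : 0 < e / 4 by rewrite divr_gt0.
  move/cvgrPdist_lt : cx => /(_ _ e4) cx.
  move/cvgrPdist_lt : cy => /(_ _ e4) cy.
  have : \forall r \near (0 : R)^'+, `|u x - u y| <= e.
    near=> r.
    have r0 : 0 < r by near: r; exact: nbhs_right_gt.
    have rx : L < x - r.
      by rewrite ltrBrDr -ltrBrDl; near: r; apply: nbhs_right_lt; rewrite subr_gt0.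
    have ry : L < y - r.
      by rewrite ltrBrDr -ltrBrDl; near: r; apply: nbhs_right_lt; rewrite subr_gt0.
    have hx := tent_average r0 rx ui; have hy := tent_average r0 ry ui.
    have fxr : davg u0 x r \is a fin_num by near: r.
    have fyr : davg u0 y r \is a fin_num by near: r.
    have dx : `|0 - fine (davg u0 x r)| < e / 4 by near: r.
    have dy : `|0 - fine (davg u0 y r)| < e / 4 by near: r.
    move: hx hy; rewrite -/u0 -(fineK fxr) -(fineK fyr) -!EFinM !lee_fin.
    rewrite (eqt x y r r0 rx ry); set A := \int[mu]_(s in _) _.
    move: dx dy; rewrite !sub0r !normrN !ltr_norml !ler_norml.
    move=> /andP[? ?] /andP[? ?] /andP[? ?] /andP[? ?]; apply/andP; split; lra.
  by case/filter_ex.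
have L0 := lebesgue_differentiation (locint_locally ui).
have [[x0 [Lx0 lx0]]|nex] := pselect (exists x, L < x /\ lebesgue_pt u0 x).
  exists (u x0); apply: (@filterS2 _ _ (ae_filter_ringOfSetsType mu) _ _ _ _ (ae_neq L) L0) => x xL lx.
  by rewrite half_lineE => Lx; apply: eqL => //; rewrite lt_neqAle eq_sym xL.
(* With no Lebesgue point beyond [L], almost no [x] remains to be checked and the constant is
   arbitrary. *)
exists 0; apply: (@filterS2 _ _ (ae_filter_ringOfSetsType mu) _ _ _ _ (ae_neq L) L0) => x xL lx.
by rewrite half_lineE => Lx; exfalso; apply: nex; exists x; rewrite lt_neqAle eq_sym xL.
Unshelve. all: by end_near. Qed.

End RealWeakDerivatives.

(** * Continuous representatives of Sobolev functions *)

Section WeakDerivatives.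
Context {R : realType}.
Local Notation mu := (@lebesgue_measure R).

Definition real_weak_derivative (L : R) (f g : R -> R) :=
  [/\ L2_real L f, L2_real L g & forall phi, test_function L phi ->
    \int[mu]_(x in half_line L) (f x * derive1 phi x) =
    - \int[mu]_(x in half_line L) (g x * phi x)].

Lemma test_primitive (L : R) phi : test_function L phi -> primitive L phi (derive1 phi).
Proof.
move=> [dphi cphi _]; apply: primitive_is_derive => // x.
by rewrite derive1E; exact: derivableP.
Qed.

Lemma test_start (L : R) phi : test_function L phi -> phi L = 0.
Proof.
move=> [_ _ [a [b [La h]]]]; apply: h.
by rewrite in_itv/= negb_and -!ltNge La.
Qed.

Lemma test_supp (L : R) phi : test_function L phi ->
  exists b, forall x, b < x -> phi x = 0 /\ derive1 phi x = 0.
Proof.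
move=> [_ _ [a [b [La h]]]]; exists b.
have h0 x : b < x -> phi x = 0.
  by move=> bx; apply: h; rewrite in_itv/= negb_and -!ltNge bx orbT.
move=> x bx; split; first exact: h0.
rewrite derive1E (@near_eq_derive _ _ _ _ (fun=> 0)) ?derive_cst//.
by near=> y; apply: h0; near: y; exact: lt_nbhsr.
Unshelve. all: by end_near. Qed.

Lemma test_integrable (L : R) u phi : locint L u -> test_function L phi ->
  mu.-integrable (half_line L) (EFin \o (fun x => u x * phi x)) /\
  mu.-integrable (half_line L) (EFin \o (fun x => u x * derive1 phi x)).
Proof.
move=> ui tphi; have [b hb] := test_supp tphi.
have cphi := primitive_continuous (test_primitive tphi).
have cdphi : continuous (derive1 phi) by case: tphi.
split; apply: (@integrable_supp _ _ _ b).
- by under eq_fun do rewrite mulrC; apply: locintM.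
- by move=> x /hb[-> _]; rewrite mulr0.
- by under eq_fun do rewrite mulrC; apply: locintM => //; exact: continuous_within_half.
- by move=> x /hb[_ ->]; rewrite mulr0.
Qed.

Lemma primitive_test (L : R) F f phi : primitive L F f -> test_function L phi ->
  \int[mu]_(x in half_line L) (F x * derive1 phi x) =
  - \int[mu]_(x in half_line L) (f x * phi x).
Proof.
move=> pF tphi; have Fi := within_locint (primitive_continuous pF).
have [Fp Fdp] := test_integrable Fi tphi.
have [fp _] := test_integrable pF.1 tphi.
have := FTC_half_line (primitiveM pF (test_primitive tphi)) (integrable_halfD fp Fdp) Fp.
rewrite RintegralD// (test_start tphi) mulr0 oppr0 => /eqP.
by rewrite addrC addr_eq0 => /eqP.
Qed.

(** Against every [derive1 phi], [f] and the indefinite integral of [g] have the same integral, so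
    by du Bois-Reymond they differ by a constant. *)
Lemma weak_derivative_primitive (L : R) f g : real_weak_derivative L f g ->
  exists2 F, primitive L F g & f = F %[ae mu in half_line L].
Proof.
move=> [f2 g2 fg].
have gi := L2_locint g2; have fi := L2_locint f2.
pose G x := \int[mu]_(t in `[L, x]) g t.
have pG : primitive L G g by split => // x _; rewrite /G set_itv1 Rintegral_set1 add0r.
have Gi := within_locint (primitive_continuous pG).
have ui : locint L (fun x => f x - G x).
  by have := fun z => integrableB _ (fi z) (Gi z); apply.
have [|c hc] := du_bois_reymond ui.
  move=> phi tphi; have [_ h1] := test_integrable fi tphi.
  have [_ h2] := test_integrable Gi tphi.
  under eq_Rintegral do rewrite mulrBl.
  by rewrite RintegralB// (primitive_test pG)// fg// subrr.
exists (fun x => G x + c).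
  split => // x Lx; rewrite {1 2}/G set_itv1 Rintegral_set1; ring.
by apply: ae_half_lineS hc => x _ <-; ring.
Qed.

Lemma primitive_weak_derivative (L : R) F f : primitive L F f -> L2_real L F -> L2_real L f ->
  real_weak_derivative L F f.
Proof. by move=> pF F2 f2; split => // phi tphi; exact: primitive_test. Qed.

Lemma ae_Rintegral_mul (L : R) (f f' phi : R -> R) : f = f' %[ae mu in half_line L] ->
  measurable_fun (half_line L) f -> measurable_fun (half_line L) f' ->
  measurable_fun (half_line L) phi ->
  \int[mu]_(x in half_line L) (f x * phi x) =
  \int[mu]_(x in half_line L) (f' x * phi x).
Proof.
move=> ff mf mf' mphi; apply: ae_eq_Rintegral; try exact: measurable_funM.
by apply: ae_half_lineS ff => x _ ->.
Qed.

Lemma real_weak_derivative_ae (L : R) (f f' g g' : R -> R) : f = f' %[ae mu in half_line L] ->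
  g = g' %[ae mu in half_line L] ->
  measurable_fun (half_line L) f' -> measurable_fun (half_line L) g' ->
  real_weak_derivative L f g -> real_weak_derivative L f' g'.
Proof.
move=> ff gg mf' mg' [f2 g2 fg]; split; [exact: L2_ae f2|exact: L2_ae g2|].
move=> phi tphi; have pp := test_primitive tphi.
rewrite -(ae_Rintegral_mul ff f2.1 mf'); last exact: locint_measurable pp.1.
rewrite -(ae_Rintegral_mul gg g2.1 mg'); last exact: within_measurable (primitive_continuous pp).
exact: fg.
Qed.

(** Both derivatives have primitives a.e. equal to [f], hence equal everywhere by continuity; the
    difference of the densities then has a constant primitive. *)
Lemma real_weak_derivative_unique (L : R) f g g' :
  real_weak_derivative L f g -> real_weak_derivative L f g' ->
  g = g' %[ae mu in half_line L].
Proof.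
move=> fg fg'; have [_ g2 _] := fg; have [_ g2' _] := fg'.
have [F pF fF] := weak_derivative_primitive fg; have [F' pF' fF'] := weak_derivative_primitive fg'.
have FF : forall x, L <= x -> F x = F' x.
  apply: ae_eq_continuous; [exact: primitive_continuous pF|exact: primitive_continuous pF'|].
  by apply: ae_half_lineI fF fF' => x _ ->.
have pD : primitive L (fun x => F x - F' x) (fun x => g x - g' x).
  have [gi Fg] := pF; have [gi' Fg'] := pF'; split.
    by have := fun z => integrableB _ (gi z) (gi' z); apply.
  by move=> x Lx; rewrite RintegralB// Fg// Fg'//; ring.
have := primitive_cst_ae0 pD => h.
apply: (ae_half_lineS _ (h _)).
  by move=> x _ /eqP; rewrite subr_eq0 => /eqP.
by move=> x Lx; rewrite !FF// !subrr.
Qed.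

Definition ReF (f : R -> R[i]) x := complex.Re (f x).
Definition ImF (f : R -> R[i]) x := complex.Im (f x).

Lemma is_weak_derivativeP (L : R) f g : L2 L f ->
  is_weak_derivative L f g <->
  real_weak_derivative L (ReF f) (ReF g) /\ real_weak_derivative L (ImF f) (ImF g).
Proof.
move=> [f2r f2i].
have E (u : R -> R[i]) (v : R -> R) : Cintegral L (fun x => u x * (v x)%:C) =
    \int[mu]_(x in half_line L) (ReF u x * v x) +i*
    \int[mu]_(x in half_line L) (ImF u x * v x).
  congr Complex; apply: eq_Rintegral => x _; rewrite /ReF /ImF; case: (u x) => a b /=.
    by rewrite mulr0 subr0.
  by rewrite mulr0 add0r.
split=> [[[g2r g2i] h]|[[_ g2r hr] [_ g2i hi]]].
  by split; split => // phi tphi; have := h _ tphi; rewrite !E => -[].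
by split => // phi tphi; rewrite !E hr// hi.
Qed.

Lemma ae_equalP (L : R) (f g : R -> R[i]) : ae_equal L f g <->
  ReF f = ReF g %[ae mu in half_line L] /\ ImF f = ImF g %[ae mu in half_line L].
Proof.
split=> [h|[h1 h2]]; first by split; apply: ae_half_lineS h => x _; rewrite /ReF /ImF => ->.
apply: ae_half_lineI h1 h2 => x _; rewrite /ReF /ImF.
by case: (f x) => a b; case: (g x) => c d /= -> ->.
Qed.

Lemma weak_derivative_unique (L : R) f g g' : L2 L f -> is_weak_derivative L f g ->
  is_weak_derivative L f g' -> ae_equal L g g'.
Proof.
move=> f2 /(is_weak_derivativeP _ f2)[h1 h2] /(is_weak_derivativeP _ f2)[h1' h2'].
by apply/ae_equalP; split; [exact: real_weak_derivative_unique h1 h1'|exact: real_weak_derivative_unique h2 h2'].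
Qed.

Lemma wderiv_spec (L : R) f : H1 L f -> is_weak_derivative L f (wderiv L f).
Proof. by move=> [_ [g fg]]; rewrite /wderiv; apply: (xgetPex _ (ex_intro _ g fg)). Qed.

Lemma weak_derivative_ae (L : R) f f' g g' : L2 L f -> L2 L f' -> L2 L g' ->
  ae_equal L f f' -> ae_equal L g g' ->
  is_weak_derivative L f g -> is_weak_derivative L f' g'.
Proof.
move=> f2 f2' g2' /ae_equalP[r1 i1] /ae_equalP[r2 i2] /(is_weak_derivativeP _ f2)[h1 h2].
apply/(is_weak_derivativeP _ f2'); case: f2' => [[mr _] [mi _]]; case: g2' => [[mr' _] [mi' _]].
by split; [exact: real_weak_derivative_ae h1|exact: real_weak_derivative_ae h2].
Qed.

Lemma wderiv_ae (L : R) f g : L2 L f -> is_weak_derivative L f g ->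
  ae_equal L (wderiv L f) g.
Proof.
move=> f2 fg; apply: (weak_derivative_unique f2 _ fg).
by apply: wderiv_spec; split => //; exists g.
Qed.

(** Continuous representatives of one class agree up to the endpoint, so the set behind [xget] is a
    singleton and the default value is never returned. *)
Lemma bdry_valueE (L : R) f (P Q : R -> R) :
  {within half_line L, continuous P} -> {within half_line L, continuous Q} ->
  ae_equal L f (fun x => P x +i* Q x) -> bdry_value L f = P L +i* Q L.
Proof.
move=> cP cQ fPQ; rewrite /bdry_value; apply: xget_unique => /=.
  by exists (fun x => P x +i* Q x).
move=> _ [h [cr ci fh <-]].
have /ae_equalP[h1 h2] : ae_equal L h (fun x => P x +i* Q x).
  by apply: ae_half_lineI fh fPQ => x _ ->.
have := ae_eq_continuous cr cP h1 (lexx L).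
have := ae_eq_continuous ci cQ h2 (lexx L).
by case: (h L) => a b /= -> ->.
Qed.

(* P and P1 are the continuous representatives of a function and of its derivative. *)
Definition real_H2 (L : R) (P P1 P2 : R -> R) :=
  [/\ primitive L P P1, primitive L P1 P2, L2_real L P, L2_real L P1 & L2_real L P2].

Lemma real_weak_derivative2_H2 (L : R) f f1 f2 :
  real_weak_derivative L f f1 -> real_weak_derivative L f1 f2 ->
  exists P P1, [/\ real_H2 L P P1 f2, f = P %[ae mu in half_line L] &
    f1 = P1 %[ae mu in half_line L]].
Proof.
move=> w1 w2; have [f_2 f1_2 _] := w1; have [_ f2_2 _] := w2.
have [P pP fP] := weak_derivative_primitive w1; have [P1 pP1 fP1] := weak_derivative_primitive w2.
have mP := within_measurable (primitive_continuous pP).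
have mP1 := within_measurable (primitive_continuous pP1).
exists P, P1; split => //; split => //; last 2 first.
- exact: L2_ae f_2.
- exact: L2_ae f1_2.
have P1i := within_locint (primitive_continuous pP1).
(* [P] was obtained as a primitive of [f1]; the a.e. equal continuous [P1] may replace [f1] under
   the integral. *)
split => // x Lx; rewrite (pP.2 x Lx); congr (_ + _).
congr fine; apply: ae_eq_integral => //.
- exact: (measurable_int mu (pP.1 x)).
- exact: (measurable_int mu (P1i x)).
- apply: (@filterS _ _ (ae_filter_ringOfSetsType mu)) fP1 => y h Dy.
  by rewrite h//; exact: half_line_sub Dy.
Qed.

Lemma H2_rep (L : R) f : H2 L f ->
  let f1 := wderiv L f in let f2 := wderiv L f1 in
  exists P P1 Q Q1 : R -> R,
   [/\ real_H2 L P P1 (ReF f2) /\ real_H2 L Q Q1 (ImF f2),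
     ae_equal L f (fun x => P x +i* Q x), ae_equal L f1 (fun x => P1 x +i* Q1 x),
     bdry_value L f = P L +i* Q L & bdry_value L f1 = P1 L +i* Q1 L].
Proof.
move=> [h1 h2] f1 f2.
have /(is_weak_derivativeP _ h1.1)[r1 i1] := wderiv_spec h1.
have /(is_weak_derivativeP _ h2.1)[r2 i2] := wderiv_spec h2.
have [P [P1 [hP rP rP1]]] := real_weak_derivative2_H2 r1 r2.
have [Q [Q1 [hQ iQ iQ1]]] := real_weak_derivative2_H2 i1 i2.
have a0 : ae_equal L f (fun x => P x +i* Q x) by apply/ae_equalP.
have a1 : ae_equal L f1 (fun x => P1 x +i* Q1 x) by apply/ae_equalP.
exists P, P1, Q, Q1; split => //.
- by case: hP hQ => p _ _ _ _ [q _ _ _ _]; apply: (bdry_valueE _ _ a0);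
    [exact: primitive_continuous p|exact: primitive_continuous q].
- by case: hP hQ => _ p _ _ _ [_ q _ _ _]; apply: (bdry_valueE _ _ a1);
    [exact: primitive_continuous p|exact: primitive_continuous q].
Qed.

End WeakDerivatives.

(** * The soliton profile *)

Section Profile.
Context {R : realType}.
Variables (L omega a : R).
Hypothesis omega0 : 0 < omega.
Local Notation s := (Num.sqrt omega).
Local Notation Psi := (@Psi R L omega a).

Let y (x : R) : R := s * (x - L) + a.
Let E (x : R) : R := expR (y x).
Let E' (x : R) : R := expR (- y x).

(* The logarithmic derivative Psi' / Psi = - sqrt omega * tanh. *)
Definition dlogPsi (x : R) : R :=
  - s * ((expR (s * (x - L) + a) - expR (- (s * (x - L) + a))) /
         (expR (s * (x - L) + a) + expR (- (s * (x - L) + a)))).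
Local Notation b := dlogPsi.

Let bE x : b x = - s * ((E x - E' x) * (E x + E' x)^-1). Proof. by []. Qed.
Let EE x : E x * E' x = 1. Proof. by rewrite /E /E' -expRD subrr expR0. Qed.
Let E0 x : 0 < E x. Proof. exact: expR_gt0. Qed.
Let E'0 x : 0 < E' x. Proof. exact: expR_gt0. Qed.
Let EE0 x : 0 < E x + E' x. Proof. exact: addr_gt0. Qed.
Let EEn0 x : E x + E' x != 0. Proof. by rewrite gt_eqF. Qed.
Let PsiE x : Psi x = Num.sqrt (2 * omega) * (2 / (E x + E' x)). Proof. by []. Qed.

Let dy (x : R) : is_derive x 1 y s.
Proof. by apply: is_derive_eq; rewrite /GRing.scale/= subr0 mulr1 addr0. Qed.

Let dE (x : R) : is_derive x 1 E (s * E x).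
Proof. by have := is_derive1_comp (is_derive_expR (y x)) (dy x); rewrite mulrC; exact. Qed.

Let dE' (x : R) : is_derive x 1 E' (- s * E' x).
Proof.
have h := is_deriveN (dy x).
by have := @is_derive1_comp _ expR (fun t => - y t) x _ _ (is_derive_expR (- y x)) h; rewrite mulrC; exact.
Qed.

Let dinv (x : R) : is_derive x 1 (fun t => (E t + E' t)^-1)
  (- ((E x + E' x) ^- 2 * (s * (E x - E' x)))).
Proof.
have h := is_deriveD (dE x) (dE' x).
have := @is_deriveV _ (fun t => E t + E' t) x _ _ (EEn0 x) h => h2.
apply: (is_derive_eq h2); rewrite /GRing.scale/=; ring.
Qed.

Lemma Psi_gt0 x : 0 < Psi x.
Proof. by rewrite PsiE mulr_gt0 ?divr_gt0 ?sqrtr_gt0 ?mulr_gt0. Qed.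

Let s2 : s ^+ 2 = omega. Proof. by rewrite sqr_sqrtr// ltW. Qed.
Let s22 : Num.sqrt (2 * omega) ^+ 2 = 2 * omega. Proof. by rewrite sqr_sqrtr// ltW ?mulr_gt0. Qed.

(** This is [tanh ^ 2 + sech ^ 2 = 1] times [omega], the first integral of the soliton equation; it
    also bounds both [b] and [Psi]. *)
Lemma dlogPsi_Psi x : b x ^+ 2 + Psi x ^+ 2 / 2 = omega.
Proof.
rewrite PsiE bE !exprMn s22 sqrrN s2.
have -> : (E x - E' x) ^+ 2 = (E x + E' x) ^+ 2 - 4 * (E x * E' x) by ring.
by rewrite EE; have n0 := EEn0 x; field.
Qed.

Lemma is_derive_Psi (x : R) : is_derive x 1 Psi (b x * Psi x).
Proof.
have h := is_deriveZ (Num.sqrt (2 * omega)) (is_deriveZ 2 (dinv x)).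
apply: (is_derive_eq h); rewrite /GRing.scale/= PsiE bE; have n0 := EEn0 x; by field.
Qed.

Lemma is_derive_dlogPsi (x : R) : is_derive x 1 b (- (Psi x ^+ 2 / 2)).
Proof.
have h := is_deriveZ (- s) (is_deriveM (is_deriveB (dE x) (dE' x)) (dinv x)).
apply: (is_derive_eq h); rewrite /GRing.scale/= PsiE !exprMn s22.
(* Inserting [E x * E' x = 1] makes both sides rational functions of the same degree in [E x] and
   [E' x], an identity within reach of [field]. *)
have -> : 2 * omega = 2 * (s ^+ 2 * (E x * E' x)) by rewrite s2 EE mulr1.
rewrite (_ : (E - E') x = E x - E' x)//; have n0 := EEn0 x; by field.
Qed.

Lemma is_derive_Psi_inv (x : R) : is_derive x 1 (fun t => (Psi t)^-1) (- b x / Psi x).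
Proof.
have p0 : Psi x != 0 by rewrite gt_eqF// Psi_gt0.
have := @is_deriveV _ Psi x _ _ p0 (is_derive_Psi x) => h.
by apply: (is_derive_eq h); rewrite /GRing.scale/=; field.
Qed.

(** The soliton equation [Psi'' = omega * Psi - Psi ^+ 3], which says that the edge operator
    annihilates [Psi]. *)
Lemma is_derive_Psi2 (x : R) :
  is_derive x 1 (fun t => b t * Psi t) (omega * Psi x - Psi x ^+ 3).
Proof.
have h := is_deriveM (is_derive_dlogPsi x) (is_derive_Psi x).
apply: (is_derive_eq h); rewrite /GRing.scale/=.
transitivity ((b x ^+ 2 + Psi x ^+ 2 / 2) * Psi x - Psi x ^+ 3); first by field.
by rewrite dlogPsi_Psi.
Qed.

Let is_derive_cont (f df : R -> R) : (forall x : R, is_derive x 1 f (df x)) -> continuous f.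
Proof.
by move=> d x; apply: differentiable_continuous; apply/derivable1_diffP; case: (d x).
Qed.

Lemma continuous_Psi : continuous Psi.
Proof. exact: is_derive_cont is_derive_Psi. Qed.

Lemma continuous_dlogPsi : continuous b.
Proof. exact: is_derive_cont is_derive_dlogPsi. Qed.

Lemma primitive_Psi : primitive L Psi (fun x => b x * Psi x).
Proof. exact: primitive_is_derive is_derive_Psi (is_derive_cont is_derive_Psi2). Qed.

Lemma primitive_dlogPsi : primitive L b (fun x => - (Psi x ^+ 2 / 2)).
Proof.
apply: (@primitive_is_derive _ L b (fun x => - (Psi x ^+ 2 / 2)) is_derive_dlogPsi) => x.
apply: (@cvgN _ R^o); apply: cvgMl.
rewrite (_ : (fun x => Psi x ^+ 2) = (fun x => Psi x * Psi x))//.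
apply: (@cvgM _ _ _ _ Psi Psi); exact: continuous_Psi.
Qed.

Lemma primitive_Psi_inv : primitive L (fun t => (Psi t)^-1) (fun x => - b x / Psi x).
Proof.
apply: (@primitive_is_derive _ L (fun t => (Psi t)^-1) (fun x => - b x / Psi x) is_derive_Psi_inv) => x; apply: cvgM.
  by apply: (@cvgN _ R^o); exact: continuous_dlogPsi.
exact: (@is_derive_cont (fun t => (Psi t)^-1) _ is_derive_Psi_inv x).
Qed.

Lemma primitive_Psi2 : primitive L (fun x => b x * Psi x)
  (fun x => omega * Psi x - Psi x ^+ 3).
Proof.
apply: (@primitive_is_derive _ L (fun x => b x * Psi x) (fun x => omega * Psi x - Psi x ^+ 3) is_derive_Psi2) => x.
apply: (@cvgB _ R^o); first by apply: cvgMr; exact: continuous_Psi.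
rewrite (_ : (fun x => Psi x ^+ 3) = (fun x => Psi x * (Psi x * Psi x))).
  apply: (@cvgM _ _ _ _ Psi (Psi \* Psi)); first exact: continuous_Psi.
  apply: (@cvgM _ _ _ _ Psi Psi); exact: continuous_Psi.
by apply/funext => t; ring.
Qed.

Lemma dlogPsi_bound x : `|b x| <= s.
Proof.
rewrite -ler_sqr ?nnegrE ?sqrtr_ge0// real_normK ?num_real// s2 -[leRHS](dlogPsi_Psi x).
by rewrite lerDl divr_ge0// sqr_ge0.
Qed.

Lemma Psi2_bound x : Psi x ^+ 2 <= 2 * omega.
Proof. by have := dlogPsi_Psi x; have := sqr_ge0 (b x); lra. Qed.

(** [Psi ^+ 2] is the derivative of [- 2 * b], which is bounded by [2 * s]; this replaces a decay
    estimate. *)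
Lemma L2_Psi : L2_real L Psi.
Proof.
have mPsi := within_measurable (primitive_continuous primitive_Psi).
split => //; have := @primitive_bounded_integrable _ L (fun x => - 2 * b x) (fun x => Psi x ^+ 2) (2 * s).
apply.
- apply: primitive_is_derive => [x|x].
    have h := is_deriveZ (- 2) (is_derive_dlogPsi x).
    by apply: (is_derive_eq h); rewrite /GRing.scale/=; field.
  rewrite (_ : (fun x => Psi x ^+ 2) = (fun x => Psi x * Psi x))//.
  by apply: (@cvgM _ _ _ _ Psi Psi); exact: continuous_Psi.
- by move=> x _; exact: sqr_ge0.
- by move=> x _; have := dlogPsi_bound x; rewrite ler_norml => /andP[? ?]; lra.
Qed.

Lemma L2_dlogPsi_mul (f : R -> R) : L2_real L f -> L2_real L (fun x => b x * f x).
Proof.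
move=> f2; apply: (L2_bounded_mul f2 (M := s)) => [|x _]; last exact: dlogPsi_bound.
exact: within_measurable (primitive_continuous primitive_dlogPsi).
Qed.

Lemma measurable_Psi_sq : measurable_fun (half_line L) (fun x => Psi x ^+ 2).
Proof.
apply: measurable_funX; exact: within_measurable (primitive_continuous primitive_Psi).
Qed.

Lemma L2_Psi_sq_mul (f : R -> R) : L2_real L f -> L2_real L (fun x => Psi x ^+ 2 * f x).
Proof.
move=> f2; apply: (L2_bounded_mul f2 (M := 2 * omega)) => [|x _].
  exact: measurable_Psi_sq.
by rewrite ger0_norm ?sqr_ge0// Psi2_bound.
Qed.

Lemma real_H2_Psi : real_H2 L Psi (fun x => b x * Psi x) (fun x => omega * Psi x - Psi x ^+ 3).
Proof.
split; [exact: primitive_Psi|exact: primitive_Psi2|exact: L2_Psi|exact: L2_dlogPsi_mul L2_Psi|].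
have h1 := L2_bounded_mul L2_Psi (g := fun=> omega) (M := omega) (measurable_cst _).
have -> : (fun x => omega * Psi x - Psi x ^+ 3) =
  fun x => omega * Psi x + (- 1) * (Psi x ^+ 2 * Psi x).
  by apply/funext => x; ring.
apply: L2D.
  by apply: h1 => x _; rewrite gtr0_norm.
apply: (L2_bounded_mul (L2_Psi_sq_mul L2_Psi) (M := 1)) => [|x _]; first exact: measurable_cst.
by rewrite normrN1.
Qed.

End Profile.

(** * Green's identities on one edge *)

Section Green.
Context {R : realType}.
Local Notation mu := (@lebesgue_measure R).
Variables (L omega a : R).
Hypothesis omega0 : 0 < omega.
Local Notation Psi := (@Psi R L omega a).
Local Notation b := (dlogPsi L omega a).

Lemma primitiveZ (k : R) (F f : R -> R) : primitive L F f ->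
  primitive L (fun x => k * F x) (fun x => k * f x).
Proof.
move=> [fi Ff]; split; first by have := fun z => integrableZl _ k (fi z); apply.
by move=> x Lx; rewrite RintegralZl// Ff//; ring.
Qed.

Lemma integrable_half_ext (f g : R -> R) : f =1 g ->
  mu.-integrable (half_line L) (EFin \o f) -> mu.-integrable (half_line L) (EFin \o g).
Proof. by move=> /funext ->. Qed.

Lemma L2Z (k : R) (f : R -> R) : L2_real L f -> L2_real L (fun x => k * f x).
Proof.
by move=> f2; apply: (L2_bounded_mul f2 (M := `|k|)) => //; exact: measurable_cst.
Qed.

Lemma L2_first_order (P P1 P2 : R -> R) : real_H2 L P P1 P2 ->
  L2_real L (fun x => P1 x - b x * P x).
Proof.
move=> [_ _ P_2 P1_2 _].
rewrite (_ : (fun x => _) = fun x => P1 x + (- 1) * (b x * P x)).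
  by apply: L2D => //; apply: L2Z; exact: L2_dlogPsi_mul.
by apply/funext => x; ring.
Qed.

Definition Lminus_real (P P2 : R -> R) (x : R) := - P2 x + omega * P x - Psi x ^+ 2 * P x.

Lemma L2_Lminus_real (P P1 P2 : R -> R) : real_H2 L P P1 P2 -> L2_real L (Lminus_real P P2).
Proof.
move=> [_ _ P_2 P1_2 P2_2].
rewrite (_ : Lminus_real _ _ = fun x => (- 1) * P2 x + (omega * P x + (- 1) * (Psi x ^+ 2 * P x))).
  apply: L2D; first exact: L2Z.
  by apply: L2D; apply: L2Z => //; exact: L2_Psi_sq_mul.
by apply/funext => x; rewrite /Lminus_real; ring.
Qed.

(* The derivative of - P' P + b P ^ 2 is (L_- P) P - (P' - b P) ^ 2. *)
Lemma green (P P1 P2 : R -> R) : real_H2 L P P1 P2 ->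
  \int[mu]_(x in half_line L) (Lminus_real P P2 x * P x) =
  \int[mu]_(x in half_line L) ((P1 x - b x * P x) ^+ 2) +
  P1 L * P L - b L * P L ^+ 2.
Proof.
move=> hP; have [pP pP1 P_2 P1_2 P2_2] := hP.
pose B x := - 1 * (P1 x * P x) + b x * (P x * P x).
pose B' x := - 1 * (P2 x * P x + P1 x * P1 x) +
  (- (Psi x ^+ 2 / 2) * (P x * P x) + b x * (P1 x * P x + P x * P1 x)).
have pB : primitive L B B'.
  apply: primitiveD; first by apply: primitiveZ; exact: primitiveM.
  apply: primitiveM; first exact: primitive_dlogPsi.
  exact: primitiveM.
have bP := L2_dlogPsi_mul a omega0 P_2.
have i1 := L2_mul P1_2 P_2; have i2 := L2_mul P2_2 P_2; have i3 := L2_mul P1_2 P1_2.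
have i4 := L2_mul bP P_2; have i5 := L2_mul bP P1_2.
have i6 := L2_mul (L2_Psi_sq_mul a omega0 P_2) P_2.
have Bi : mu.-integrable (half_line L) (EFin \o B).
  apply: integrable_half_ext (integrable_halfD (integrable_halfZ (- 1) i1) i4) => x.
  by rewrite /B; ring.
have Bi' : mu.-integrable (half_line L) (EFin \o B').
  apply: integrable_half_ext (integrable_halfD (integrable_halfZ (- 1) (integrable_halfD i2 i3))
     (integrable_halfD (integrable_halfZ (- 2^-1) i6) (integrable_halfZ 2 i5))) => x.
  by rewrite /B'; field.
have := FTC_half_line pB Bi' Bi.
rewrite {1}/B => hB; rewrite -addrA.
have -> : P1 L * P L - b L * P L ^+ 2 = - (- 1 * (P1 L * P L) + b L * (P L * P L)) by ring.
rewrite -hB -RintegralD//; last exact: (L2_first_order hP).2.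
apply: eq_Rintegral => x _; rewrite /Lminus_real /B'.
have := dlogPsi_Psi L a omega0 x; set bx := b x; set px := Psi x => e.
rewrite -[in LHS]e; by field.
Qed.

(** The potential cancels, and what remains is the derivative of the Wronskian [P1 * Q - Q1 * P].
    For [P + iQ] the left side is the imaginary part of the quadratic form. *)
Lemma green_im (P P1 P2 Q Q1 Q2 : R -> R) : real_H2 L P P1 P2 -> real_H2 L Q Q1 Q2 ->
  \int[mu]_(x in half_line L) (Lminus_real Q Q2 x * P x - Lminus_real P P2 x * Q x) =
  Q1 L * P L - P1 L * Q L.
Proof.
move=> [pP pP1 P_2 P1_2 P2_2] [pQ pQ1 Q_2 Q1_2 Q2_2].
have p := primitiveD (primitiveM pP1 pQ) (primitiveZ (- 1) (primitiveM pQ1 pP)).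
have i1 := L2_mul P2_2 Q_2; have i2 := L2_mul P1_2 Q1_2.
have i3 := L2_mul Q2_2 P_2; have i4 := L2_mul P1_2 Q_2; have i5 := L2_mul Q1_2 P_2.
have := FTC_half_line p.
have -> : - (P1 L * Q L + -1 * (Q1 L * P L)) = Q1 L * P L - P1 L * Q L by ring.
move=> <-.
- by apply: eq_Rintegral => x _; rewrite /Lminus_real; ring.
- apply: integrable_half_ext (integrable_halfD i1 (integrable_halfZ (- 1) i3)) => x; ring.
- exact: integrable_halfD i4 (integrable_halfZ (- 1) i5).
Qed.

Lemma Rintegral_sq_eq0 (h : R -> R) : {within half_line L, continuous h} ->
  mu.-integrable (half_line L) (EFin \o (fun x => h x ^+ 2)) ->
  \int[mu]_(x in half_line L) (h x ^+ 2) = 0 -> forall x, L <= x -> h x = 0.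
Proof.
move=> ch hi h0; apply: (@ae_eq_continuous _ L h (fun=> 0)) => //.
  by apply: continuous_within_half => x; exact: cvg_cst.
have mh := measurable_int mu hi.
have : (\int[mu]_(x in half_line L) `|(EFin \o (fun x => h x ^+ 2)%R) x| = 0)%E.
  transitivity (\int[mu]_(x in half_line L) (h x ^+ 2)%R%:E)%E.
    by apply: eq_integral => x _; rewrite /= ger0_norm// sqr_ge0.
  move: h0; rewrite /Rintegral => h0; rewrite -[LHS]fineK ?h0//.
  by apply: integrable_fin_num.
move/(ae_eq_integral_abs _ _ mh) => ae0; apply: (ae_half_lineS _ (ae0 _)) => //.
by move=> x _ [] /eqP; rewrite sqrf_eq0 => /eqP.
Qed.

(** The quotient [P / Psi] is a product of primitives, with density [(P1 - b * P) / Psi = 0], so it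
    keeps its value at [L]. *)
Lemma first_order_eq0 (P P1 : R -> R) : primitive L P P1 ->
  (forall x, L <= x -> P1 x - b x * P x = 0) ->
  exists c : R, forall x, L <= x -> P x = c * Psi x.
Proof.
move=> pP h; have pR := primitiveM pP (primitive_Psi_inv L a omega0).
exists (P L * (Psi L)^-1) => x Lx.
have := pR.2 x Lx.
rewrite (_ : \int[mu]_(t in _) _ = 0) ?addr0 => [<-|].
  by rewrite mulfVK// gt_eqF// Psi_gt0.
transitivity (\int[mu]_(t in `[L, x]) 0).
  apply: eq_Rintegral => t; rewrite inE/= in_itv/= => /andP[Lt _].
  have /eqP := h t Lt; rewrite subr_eq0 => /eqP ->.
  by field; rewrite gt_eqF// Psi_gt0.
by rewrite Rintegral_cst// mul0r.
Qed.

Lemma real_H2_first_order_eq0 (P P1 P2 : R -> R) : real_H2 L P P1 P2 ->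
  \int[mu]_(x in half_line L) ((P1 x - b x * P x) ^+ 2) = 0 ->
  exists c : R, forall x, L <= x -> P x = c * Psi x /\ P1 x = c * (b x * Psi x).
Proof.
move=> hP h0; have [pP pP1 _ _ _] := hP.
have h : forall x, L <= x -> P1 x - b x * P x = 0.
  apply: Rintegral_sq_eq0 (L2_first_order hP).2 h0.
  move=> x; apply: (@cvgB _ R^o); first exact: (primitive_continuous pP1).
  apply: cvgM; first exact: (primitive_continuous (primitive_dlogPsi L a omega0)).
  exact: (primitive_continuous pP).
have [c hc] := first_order_eq0 pP h; exists c => x Lx; split; first exact: hc.
by have /eqP := h x Lx; rewrite subr_eq0 => /eqP ->; rewrite hc//; ring.
Qed.

End Green.

Section BoundaryValues.
Context {R : realType}.
Variables (L omega t : R).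
Hypothesis omega0 : 0 < omega.
Hypothesis t01 : 0 < t < 1.

(** This is [tanh (arctanh t) = t], which follows from [q ^+ 2 = (1 + t) / (1 - t)] for
    [q = expR (arctanh t)]. *)
Lemma dlogPsi_arctanh : dlogPsi L omega (arctanh t) L = - Num.sqrt omega * t.
Proof.
have /andP[t0 t1] := t01.
rewrite /dlogPsi subrr mulr0 add0r; congr (_ * _).
set q := expR _; set q' := expR _.
have qq : q * q' = 1 by rewrite /q /q' -expRD subrr expR0.
have q2 : q ^+ 2 = (1 + t) / (1 - t).
  rewrite /q -expRM_natl /arctanh mulrC divfK ?pnatr_eq0//.
  by rewrite lnK// posrE divr_gt0//; lra.
have q0 : 0 < q by exact: expR_gt0.
have q'0 : 0 < q' by exact: expR_gt0.
have s0 : q + q' != 0 by rewrite gt_eqF// addr_gt0.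
have tn : 1 - t != 0 by rewrite gt_eqF//; lra.
apply/eqP; rewrite eq_sym -subr_eq0.
have : (1 - t) * q ^+ 2 = 1 + t by rewrite q2; field.
move=> h.
have -> : t - (q - q') / (q + q') = (q * ((t - 1) * q + (1 + t) * q')) / (q * (q + q')).
  field; rewrite s0 gt_eqF//.
rewrite mulf_eq0; apply/orP; left.
apply/eqP; have -> : q * ((t - 1) * q + (1 + t) * q') = - ((1 - t) * q ^+ 2) + (1 + t) * (q * q') by ring.
by rewrite h qq; ring.
Qed.

Lemma Psi_arctanh :
  Psi L omega (arctanh t) L = Num.sqrt (2 * omega) * Num.sqrt (1 - t ^+ 2).
Proof.
have /andP[t0 t1] := t01.
have h := dlogPsi_Psi L (arctanh t) omega0 L.
have p0 := Psi_gt0 L (arctanh t) omega0 L.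
rewrite -sqrtrM ?mulr_ge0 ?(ltW omega0)//.
rewrite -[LHS]gtr0_norm// -sqrtr_sqr; congr Num.sqrt.
move: h; rewrite dlogPsi_arctanh exprMn sqrrN sqr_sqrtr ?(ltW omega0)// => h.
lra.
Qed.

End BoundaryValues.

(** * The star graph *)

Section EdgeShifts.
Context {R : realType}.
Variables (Z omega : R) (N n : nat).
Hypotheses (hZ : Z < 0) (hN : (2 <= N)%N) (hn : (1 <= n <= N - 1)%N).
Hypothesis homega : omega_star Z N n < omega.

Lemma omega_gt0 : 0 < omega.
Proof.
apply: le_lt_trans homega; rewrite /omega_star divr_ge0 ?sqr_ge0//.
Qed.

Let n0 : (0 : R) < n%:R. Proof. by rewrite ltr0n; case/andP: hn. Qed.
Let Nn0 : (0 : R) < N%:R - n%:R.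
Proof. by rewrite subr_gt0 ltr_nat; case/andP: hn => h1 h2; rewrite -(subnKC hN) in h2 *; rewrite ltnS. Qed.

Lemma t_star01 : 0 < (t_star N n : R) < 1.
Proof.
have p0 : 0 < n%:R `^ (2 / 3) :> R by rewrite powR_gt0.
have q0 : 0 < (N%:R - n%:R) `^ (2 / 3) :> R by rewrite powR_gt0.
rewrite /t_star; set p := _ `^ _ in p0 *; set q := _ `^ _ in q0 *.
rewrite sqrtr_gt0 divr_gt0 ?addr_gt0//= -sqrtr1 ltr_sqrt//.
by rewrite ltr_pdivrMr ?addr_gt0// mul1r ltrDl.
Qed.

Lemma alpha_continuous (x : R) : 0 < x < 1 -> {for x, continuous (alpha N n : R -> R)}.
Proof.
move=> /andP[x0 x1]; have h : 0 < 1 - x ^+ 2 by rewrite subr_gt0 expr_lt1// ltW.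
apply: (@cvgD _ R^o); apply: cvgMr; apply: cvgV.
- by rewrite gt_eqF.
- exact: cvg_id.
- by rewrite gt_eqF// sqrtr_gt0.
- apply: continuous_cvg; first exact: sqrt_continuous.
  apply: (@cvgB _ R^o); first exact: cvg_cst.
  exact: exprn_continuous.
Qed.

Lemma alpha_gt (x : R) : 0 < x < 1 -> n%:R / x < alpha N n x.
Proof.
move=> /andP[x0 x1]; have h : 0 < 1 - x ^+ 2 by rewrite subr_gt0 expr_lt1// ltW.
by rewrite /alpha ltrDl divr_gt0// sqrtr_gt0.
Qed.

(** [xget] needs a witness. With [T = - Z * sqrt omega], the intermediate value theorem applies on
    [[n / T, t_star]]: [alpha] exceeds [n / x], which is [T] at the left end, and
    [omega_star < omega] puts [alpha] below [T] at the right end. *)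
Lemma t_1_spec : 0 < t_1 Z omega N n < t_star N n /\
  alpha N n (t_1 Z omega N n) = - Z * Num.sqrt omega.
Proof.
have [s0 s1] := andP t_star01; have o0 := omega_gt0.
pose T := - Z * Num.sqrt omega.
have T0 : 0 < T by rewrite mulr_gt0 ?oppr_gt0 ?sqrtr_gt0.
have a0 : 0 < alpha N n (t_star N n) :> R.
  by apply: lt_trans (alpha_gt t_star01); rewrite divr_gt0.
have aT : alpha N n (t_star N n) < T.
  rewrite -ltr_sqr ?nnegrE ?(ltW a0) ?(ltW T0)// /T exprMn sqrrN sqr_sqrtr ?ltW//.
  by move: homega; rewrite /omega_star ltr_pdivrMr 1?mulrC// exprn_even_gt0//= lt_eqF.
pose t0 := n%:R / T.
have t00 : 0 < t0 by rewrite divr_gt0.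
have t0s : t0 < t_star N n.
  rewrite ltr_pdivrMr// mulrC -ltr_pdivrMr//.
  exact: lt_trans (alpha_gt t_star01) aT.
have t01 : 0 < t0 < 1 by rewrite t00 (lt_trans t0s).
have Ta : T < alpha N n t0.
  have := alpha_gt t01; rewrite /t0 invf_div mulrC divfK// gt_eqF//.
have [||c] := @IVT R (alpha N n) t0 (t_star N n) T (ltW t0s).
- apply: continuous_in_subspaceT => x; rewrite inE/= in_itv/= => /andP[h1 h2].
  by apply: alpha_continuous; rewrite (lt_le_trans t00)// (le_lt_trans h2).
- by rewrite ge_min le_max (ltW Ta) (ltW aT) orbT.
rewrite in_itv/= => /andP[c0 cs] ac.
apply: (@xgetPex R 0 [set u | 0 < u < t_star N n /\ alpha N n u = - Z * Num.sqrt omega]).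
exists c; split; last by rewrite ac.
rewrite (lt_le_trans t00)//= lt_neqAle cs andbT; apply/eqP => e.
by move: aT; rewrite -e ac ltxx.
Qed.

Definition edge_t (i : 'I_N) : R := if (i < n)%N then t_1 Z omega N n else t_N Z omega N n.
Local Notation tau := (t_1 Z omega N n * t_N Z omega N n).

Lemma t_1_01 : 0 < t_1 Z omega N n < 1.
Proof.
have [/andP[h1 h2] _] := t_1_spec; have /andP[_ h3] := t_star01.
by rewrite h1 (lt_trans h2).
Qed.

Lemma t_N_01 : 0 < t_N Z omega N n < 1.
Proof.
have /andP[h1 h2] := t_1_01; rewrite /t_N sqrtr_gt0 subr_gt0 expr_lt1 ?h2 ?ltW//=.
by rewrite -[ltRHS]sqrtr1 ltr_sqrt ?ltr01// ltrBlDr ltrDl exprn_gt0.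
Qed.

Lemma edge_t01 i : 0 < edge_t i < 1.
Proof. by rewrite /edge_t; case: ifP => _; [exact: t_1_01|exact: t_N_01]. Qed.

Lemma edge_shiftE i : edge_shift Z omega n i = arctanh (edge_t i).
Proof. by rewrite /edge_shift /edge_t; case: ifP. Qed.

(** [t_1] and [t_N] have squares summing to 1, so [t * sqrt (1 - t ^+ 2)] takes the same value [tau]
    at both. This makes the slopes of the profiles agree at the vertex. *)
Lemma edge_t_compl i : Num.sqrt (1 - edge_t i ^+ 2) = tau / edge_t i.
Proof.
have /andP[h1 h2] := t_1_01; have /andP[k1 k2] := t_N_01.
rewrite /edge_t; case: ifP => _; first by rewrite mulrC mulKf ?gt_eqF.
rewrite mulfK ?gt_eqF// {1}/t_N sqr_sqrtr ?subr_ge0 ?expr_le1 ?ltW//.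
by rewrite opprB addrC subrK sqrtr_sqr gtr0_norm.
Qed.

(** Grouping the edges gives [n / t_1 + (N - n) / t_N], which is [alpha] at [t_1], so this is the
    defining equation of [t_1]. *)
Lemma sum_edge_t : \sum_(i < N) (edge_t i)^-1 = - Z * Num.sqrt omega.
Proof.
have nN : (n <= N)%N.
  by case/andP: hn => _ h; apply: leq_trans h _; exact: leq_subr.
have [_ <-] := t_1_spec; rewrite /alpha /edge_t -/(t_N Z omega N n).
pose g (i : nat) := (if (i < n)%N then t_1 Z omega N n else t_N Z omega N n)^-1.
rewrite -(big_mkord xpredT g) (big_cat_nat (leq0n n) nN)//=; congr (_ + _).
  rewrite (eq_big_nat _ _ (F2 := fun=> (t_1 Z omega N n)^-1)).
    by rewrite sumr_const_nat subn0 mulr_natl.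
  by move=> i /andP[_ h]; rewrite /g h.
rewrite (eq_big_nat _ _ (F2 := fun=> (t_N Z omega N n)^-1)).
  by rewrite sumr_const_nat -[LHS]mulr_natl natrB.
by move=> i /andP[h _]; rewrite /g ltnNge h.
Qed.

End EdgeShifts.

(** * The energy identity for real functions on the graph *)

Section Energy.
Context {R : realType}.
Local Notation mu := (@lebesgue_measure R).
Variables (L Z omega : R) (N : nat) (t : 'I_N -> R).
Hypotheses (omega0 : 0 < omega) (t01 : forall i, 0 < t i < 1).
Hypothesis sumt : \sum_(i < N) (t i)^-1 = - Z * Num.sqrt omega.
Local Notation a := (fun i => arctanh (t i)).
Local Notation s := (Num.sqrt omega).

Lemma boundary_square (x : 'I_N -> R) (d : R) : \sum_i x i = Z * d ->
  \sum_i (d * x i + s * t i * x i ^+ 2) =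
  s * \sum_i t i * (x i + d / (s * t i)) ^+ 2.
Proof.
move=> hx; have s0 : s != 0 by rewrite gt_eqF// sqrtr_gt0.
have tn i : t i != 0 by case/andP: (t01 i) => h _; rewrite gt_eqF.
rewrite mulr_sumr.
(* Completing the square on edge [i] adds [d * x i + d ^+ 2 / (s * t i)]; by the two sum conditions
   these excesses total [Z * d ^+ 2 - Z * d ^+ 2 = 0]. *)
have -> : \sum_i s * (t i * (x i + d / (s * t i)) ^+ 2) =
    \sum_i ((d * x i + s * t i * x i ^+ 2) + (d * x i + d ^+ 2 / s * (t i)^-1)).
  by apply: eq_bigr => i _; have h := tn i; field; rewrite h.
rewrite [RHS]big_split /= [X in _ = _ + X]big_split /= -!mulr_sumr hx sumt.
rewrite -[LHS]addr0; congr (_ + _).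
by field.
Qed.

Lemma energy (P P1 P2 : 'I_N -> R -> R) (d : R) :
  (forall i, real_H2 L (P i) (P1 i) (P2 i)) -> (forall i, P1 i L = d) ->
  \sum_i P i L = Z * d ->
  \sum_i \int[mu]_(x in half_line L) (Lminus_real L omega (a i) (P i) (P2 i) x * P i x) =
  \sum_i \int[mu]_(x in half_line L) ((P1 i x - dlogPsi L omega (a i) x * P i x) ^+ 2) +
  s * \sum_i t i * (P i L + d / (s * t i)) ^+ 2.
Proof.
move=> hP hd hs; rewrite -boundary_square// -big_split/=; apply: eq_bigr => i _.
rewrite (green _ omega0 (hP i)) -addrA hd dlogPsi_arctanh//; ring.
Qed.

Lemma energy_ge0 (P P1 P2 : 'I_N -> R -> R) (d : R) :
  (forall i, real_H2 L (P i) (P1 i) (P2 i)) -> (forall i, P1 i L = d) ->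
  \sum_i P i L = Z * d ->
  0 <= \sum_i \int[mu]_(x in half_line L) (Lminus_real L omega (a i) (P i) (P2 i) x * P i x).
Proof.
move=> hP hd hs; rewrite (energy hP hd hs) addr_ge0//.
  by apply: sumr_ge0 => i _; apply: Rintegral_ge0 => x _; exact: sqr_ge0.
rewrite mulr_ge0 ?sqrtr_ge0// sumr_ge0// => i _; rewrite mulr_ge0 ?sqr_ge0//.
by case/andP: (t01 i) => /ltW.
Qed.

Variable tau : R.
Hypotheses (tau0 : 0 < tau) (tE : forall i, Num.sqrt (1 - t i ^+ 2) = tau / t i).
Local Notation kappa := (- s * Num.sqrt (2 * omega) * tau).

Lemma slope_boundary i : dlogPsi L omega (a i) L * Psi L omega (a i) L = kappa.
Proof.
rewrite dlogPsi_arctanh// Psi_arctanh// tE.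
have : t i != 0 by case/andP: (t01 i) => h _; rewrite gt_eqF.
by move=> h; field.
Qed.

Lemma sum_Psi_boundary : \sum_i Psi L omega (a i) L = Z * kappa.
Proof.
under eq_bigr do rewrite Psi_arctanh// tE mulrA.
by rewrite -mulr_sumr sumt; ring.
Qed.

Lemma energy_eq0 (P P1 P2 : 'I_N -> R -> R) (d : R) :
  (forall i, real_H2 L (P i) (P1 i) (P2 i)) -> (forall i, P1 i L = d) ->
  \sum_i P i L = Z * d ->
  (forall i, \int[mu]_(x in half_line L) (Lminus_real L omega (a i) (P i) (P2 i) x * P i x) = 0) ->
  forall i x, L <= x -> P i x = d / kappa * Psi L omega (a i) x.
Proof.
move=> hP hd hs h0; have := energy hP hd hs.
rewrite big1 => [/esym/eqP|i _]; last exact: h0.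
have I0 i : 0 <= \int[mu]_(x in half_line L) ((P1 i x - dlogPsi L omega (a i) x * P i x) ^+ 2).
  by apply: Rintegral_ge0 => x _; exact: sqr_ge0.
rewrite paddr_eq0; last 2 first.
- exact: sumr_ge0.
- rewrite mulr_ge0 ?sqrtr_ge0// sumr_ge0// => i _; rewrite mulr_ge0 ?sqr_ge0//.
  by case/andP: (t01 i) => /ltW.
move=> /andP[/eqP /(psumr_eq0P (fun i _ => I0 i)) h _] i x Lx.
have [c hc] := real_H2_first_order_eq0 omega0 (hP i) (h i isT).
have [-> _] := hc x Lx; have [_] := hc L (lexx L).
rewrite hd slope_boundary => ->; rewrite mulfK// mulf_neq0//; last by rewrite gt_eqF.
by rewrite mulf_neq0// ?oppr_eq0 gt_eqF// sqrtr_gt0// mulr_gt0.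
Qed.

End Energy.

(** * The complex edge operator *)

Section Edge.
Context {R : realType}.
Local Notation mu := (@lebesgue_measure R).
Variables (L omega a : R).
Hypothesis omega0 : 0 < omega.

Lemma measurable_Lminus_real (f f2 : R -> R) : measurable_fun (half_line L) f ->
  measurable_fun (half_line L) f2 -> measurable_fun (half_line L) (Lminus_real L omega a f f2).
Proof.
move=> mf mf2; apply: measurable_funB; last first.
  by apply: measurable_funM => //; exact: measurable_Psi_sq.
apply: measurable_funD; first exact: measurableT_comp.
by apply: measurable_funM => //; exact: measurable_cst.
Qed.

Lemma Lminus_edgeE (f : R -> R[i]) x : let f2 := wderiv L (wderiv L f) in
  Lminus_edge L omega a f x =
  Lminus_real L omega a (ReF f) (ReF f2) x +i* Lminus_real L omega a (ImF f) (ImF f2) x.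
Proof.
rewrite /= /Lminus_edge /Lminus_real /ReF /ImF; case: (f x) => p q.
case: (wderiv L (wderiv L f) x) => p2 q2.
by apply/eqP; rewrite eq_complex /=; apply/andP; split; apply/eqP; ring.
Qed.

(** Real coefficients decouple the real part of the form into two real energies and leave a
    Wronskian as imaginary part. Under the integral [f] is exchanged for its continuous
    representative; the second weak derivative stays as it is. *)
Lemma Lminus_edge_inner (f : R -> R[i]) (P P1 Q Q1 : R -> R) :
  let f2 := wderiv L (wderiv L f) in L2 L f ->
  real_H2 L P P1 (ReF f2) -> real_H2 L Q Q1 (ImF f2) ->
  ae_equal L f (fun x => P x +i* Q x) ->
  Cintegral L (fun x => Lminus_edge L omega a f x * (f x)^*) =
  (\int[mu]_(x in half_line L) (Lminus_real L omega a P (ReF f2) x * P x) +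
   \int[mu]_(x in half_line L) (Lminus_real L omega a Q (ImF f2) x * Q x)) +i*
  (Q1 L * P L - P1 L * Q L).
Proof.
move=> f2 [[mr _] [mi _]] hP hQ /ae_equalP[rP iQ].
have [_ _ P_2 _ p2_2] := hP; have [_ _ Q_2 _ q2_2] := hQ.
have LP := L2_Lminus_real a omega0 hP; have LQ := L2_Lminus_real a omega0 hQ.
congr Complex.
- rewrite -RintegralD//; [|exact: L2_mul|exact: L2_mul].
  rewrite (_ : (fun x => _) = fun x =>
      Lminus_real L omega a (ReF f) (ReF f2) x * ReF f x + Lminus_real L omega a (ImF f) (ImF f2) x * ImF f x).
    apply: ae_eq_Rintegral.
    + by apply: ae_half_lineI rP iQ => x _; rewrite /Lminus_real => -> ->.
    + apply: measurable_funD; apply: measurable_funM => //; apply: measurable_Lminus_real => //.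
        exact: p2_2.1.
      exact: q2_2.1.
    + by apply: measurable_funD; apply: measurable_funM => //; [exact: LP.1|exact: P_2.1|exact: LQ.1|exact: Q_2.1].
  apply/funext => x; rewrite Lminus_edgeE; rewrite /ReF /ImF; case: (f x) => p q /=; ring.
- rewrite -(green_im omega a hP hQ).
  rewrite (_ : (fun x => _) = fun x =>
      Lminus_real L omega a (ImF f) (ImF f2) x * ReF f x - Lminus_real L omega a (ReF f) (ReF f2) x * ImF f x).
    apply: ae_eq_Rintegral.
    + by apply: ae_half_lineI rP iQ => x _; rewrite /Lminus_real => -> ->.
    + apply: measurable_funB; apply: measurable_funM => //; apply: measurable_Lminus_real => //.
        exact: q2_2.1.
      exact: p2_2.1.
    + by apply: measurable_funB; apply: measurable_funM => //; [exact: LQ.1|exact: P_2.1|exact: LP.1|exact: Q_2.1].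
  apply/funext => x; rewrite Lminus_edgeE; rewrite /ReF /ImF; case: (f x) => p q /=; ring.
Qed.

Lemma Lminus_edge_ae0 (f : R -> R[i]) (P P1 Q Q1 : R -> R) :
  let f2 := wderiv L (wderiv L f) in
  real_H2 L P P1 (ReF f2) -> real_H2 L Q Q1 (ImF f2) ->
  ae_equal L f (fun x => P x +i* Q x) ->
  ae_equal L (Lminus_edge L omega a f) (fun=> 0) ->
  \int[mu]_(x in half_line L) (Lminus_real L omega a P (ReF f2) x * P x) = 0 /\
  \int[mu]_(x in half_line L) (Lminus_real L omega a Q (ImF f2) x * Q x) = 0.
Proof.
move=> f2 hP hQ /ae_equalP[rP iQ] /ae_equalP[r0 i0].
have [_ _ P_2 _ _] := hP; have [_ _ Q_2 _ _] := hQ.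
have LP := L2_Lminus_real a omega0 hP; have LQ := L2_Lminus_real a omega0 hQ.
have int0 : \int[mu]_(x in half_line L) 0 = 0 by rewrite Rintegral_cst// mul0r.
split; rewrite -[RHS]int0; apply: ae_eq_Rintegral; try exact: measurable_cst.
- apply: ae_half_lineI rP r0 => x _ eP; rewrite {1}/ReF Lminus_edgeE /= => e.
  rewrite (_ : Lminus_real _ _ _ _ _ x = Lminus_real L omega a (ReF f) (ReF f2) x); last by rewrite /Lminus_real eP.
  by rewrite e mul0r.
- exact: measurable_funM LP.1 P_2.1.
- apply: ae_half_lineI iQ i0 => x _ eQ; rewrite {1}/ImF Lminus_edgeE /= => e.
  rewrite (_ : Lminus_real _ _ _ _ _ x = Lminus_real L omega a (ImF f) (ImF f2) x); last by rewrite /Lminus_real eQ.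
  by rewrite e mul0r.
- exact: measurable_funM LQ.1 Q_2.1.
Qed.

Definition Cscale (c : R[i]) (u : R -> R) (x : R) : R[i] := c * (u x)%:C.

Lemma ReF_Cscale c u : ReF (Cscale c u) = fun x => complex.Re c * u x.
Proof. by apply/funext => x; rewrite /ReF /Cscale; case: c => p q /=; ring. Qed.

Lemma ImF_Cscale c u : ImF (Cscale c u) = fun x => complex.Im c * u x.
Proof. by apply/funext => x; rewrite /ImF /Cscale; case: c => p q /=; ring. Qed.

Lemma L2_Cscale c u : L2_real L u -> L2 L (Cscale c u).
Proof.
by move=> u2; split; [rewrite -/(ReF (Cscale c u)) ReF_Cscale|rewrite -/(ImF (Cscale c u)) ImF_Cscale]; exact: L2Z.
Qed.

Lemma Cscale_weak_derivative c u u1 : primitive L u u1 -> L2_real L u ->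
  L2_real L u1 -> is_weak_derivative L (Cscale c u) (Cscale c u1).
Proof.
move=> pu u2 u12; apply/is_weak_derivativeP; first exact: L2_Cscale.
by rewrite !ReF_Cscale !ImF_Cscale; split; apply: primitive_weak_derivative;
  [exact: primitiveZ|exact: L2Z|exact: L2Z|exact: primitiveZ|exact: L2Z|exact: L2Z].
Qed.

Lemma ae_equal_sym (f g : R -> R[i]) : ae_equal L f g -> ae_equal L g f.
Proof. by move=> fg; apply: ae_half_lineS fg => x _ ->. Qed.

Lemma ae_equal_refl (f : R -> R[i]) : ae_equal L f f.
Proof. by apply: aeW. Qed.

Lemma ae_equal_trans (f g h : R -> R[i]) : ae_equal L f g -> ae_equal L g h -> ae_equal L f h.
Proof. by move=> fg gh; apply: ae_half_lineI fg gh => x _ ->. Qed.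

(** Members of the span equal a scaled profile only a.e., and [wderiv] is only a chosen
    representative, so derivatives and boundary values are transferred through uniqueness up to null
    sets. *)
Lemma Cscale_H2 c u u1 u2 (v : R -> R[i]) : real_H2 L u u1 u2 -> L2 L v ->
  ae_equal L v (Cscale c u) ->
  [/\ H2 L v, ae_equal L (wderiv L (wderiv L v)) (Cscale c u2),
   bdry_value L v = c * (u L)%:C & bdry_value L (wderiv L v) = c * (u1 L)%:C].
Proof.
move=> [pu pu1 u_2 u1_2 u2_2] v2 vc.
have cL := L2_Cscale c u_2; have c1L := L2_Cscale c u1_2; have c2L := L2_Cscale c u2_2.
have w1 : is_weak_derivative L v (Cscale c u1).
  exact: weak_derivative_ae cL v2 c1L (ae_equal_sym vc) (ae_equal_refl _) (Cscale_weak_derivative c pu u_2 u1_2).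
have h1 : H1 L v by split => //; exists (Cscale c u1).
have vc1 := wderiv_ae v2 w1.
have v12 : L2 L (wderiv L v) by case: (wderiv_spec h1).
have w2 : is_weak_derivative L (wderiv L v) (Cscale c u2).
  exact: weak_derivative_ae c1L v12 c2L (ae_equal_sym vc1) (ae_equal_refl _) (Cscale_weak_derivative c pu1 u1_2 u2_2).
have vc2 := wderiv_ae v12 w2.
have bdry w f f' : primitive L f f' -> ae_equal L w (Cscale c f) -> bdry_value L w = c * (f L)%:C.
  move=> pf wf.
  have pr := primitive_continuous (primitiveZ (complex.Re c) pf).
  have pi := primitive_continuous (primitiveZ (complex.Im c) pf).
  rewrite (bdry_valueE pr pi).
    by apply/eqP; rewrite eq_complex; case: (c) => p q /=; apply/andP; split; apply/eqP; ring.
  apply: ae_half_lineS wf => x _ ->.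
  by apply/eqP; rewrite /Cscale eq_complex; case: (c) => p q /=; apply/andP; split; apply/eqP; ring.
split; [|exact: vc2|exact: bdry pu vc|exact: bdry pu1 vc1].
by split => //; split => //; exists (Cscale c u2).
Qed.

End Edge.

(** * Vertex conditions, nonnegativity and the kernel *)

Section Graph.
Context {R : realType}.
Local Notation mu := (@lebesgue_measure R).

Lemma sum_complex (I : finType) (A B : I -> R) :
  \sum_i (A i +i* B i) = (\sum_i A i) +i* (\sum_i B i).
Proof. by elim/big_rec3: _ => // i x y _ _ ->. Qed.

(** Because [Z] is real, the vertex conditions split into one copy for the real parts, with slope
    [d], and one for the imaginary parts, with slope [e]. *)
Lemma dom_delta'_representatives (L Z : R) (N : nat) (v : graph_fun N) : (2 <= N)%N -> dom_delta' L Z N v ->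
  exists (P P1 Q Q1 : 'I_N -> R -> R) (d e : R),
   [/\ forall i, let f2 := wderiv L (wderiv L (v i)) in
        [/\ real_H2 L (P i) (P1 i) (ReF f2), real_H2 L (Q i) (Q1 i) (ImF f2) &
            ae_equal L (v i) (fun x => P i x +i* Q i x)],
     forall i, P1 i L = d /\ Q1 i L = e,
     \sum_i P i L = Z * d & \sum_i Q i L = Z * e].
Proof.
move=> hN [hH hd hs].
have /choice[u hu] : forall i, exists u : ((R -> R) * (R -> R)) * ((R -> R) * (R -> R)),
   let f1 := wderiv L (v i) in let f2 := wderiv L f1 in
   [/\ real_H2 L u.1.1 u.1.2 (ReF f2) /\ real_H2 L u.2.1 u.2.2 (ImF f2),
     ae_equal L (v i) (fun x => u.1.1 x +i* u.2.1 x),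
     ae_equal L f1 (fun x => u.1.2 x +i* u.2.2 x),
     bdry_value L (v i) = u.1.1 L +i* u.2.1 L & bdry_value L f1 = u.1.2 L +i* u.2.2 L].
  by move=> i; have [P [P1 [Q [Q1 h]]]] := H2_rep (hH i); exists ((P, P1), (Q, Q1)).
pose i0 : 'I_N := Ordinal (ltnW hN).
exists (fun i => (u i).1.1), (fun i => (u i).1.2), (fun i => (u i).2.1), (fun i => (u i).2.2).
exists ((u i0).1.2 L), ((u i0).2.2 L).
have sumE := hs i0 erefl.
have [_ _ _ _ b0] := hu i0.
rewrite b0 (eq_bigr (fun i => (u i).1.1 L +i* (u i).2.1 L)) in sumE; last first.
  by move=> i _; case: (hu i).
rewrite sum_complex in sumE; case: sumE => sr si.
split.
- by move=> i; case: (hu i) => -[].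
- move=> i; have [_ _ _ _ bi] := hu i; have := hd i i0.
  by rewrite bi b0 => -[].
- by rewrite sr; ring.
- by rewrite si; ring.
Qed.

End Graph.

Theorem proposition5p2 (R : realType) (L Z omega : R) (N n : nat)
    (hL : 0 <= L) (hZ : Z < 0) (hN : (2 <= N)%N) (hn : (1 <= n <= N - 1)%N)
    (homega : omega_star Z N n < omega) :
  let D := dom_delta' L Z N in
  let T := Lminus L Z omega N n in
  let Theta_n := Theta L Z omega N n in
  [/\ (D `&` X1perp L N n <> zero_space L N ->
         op_nonneg_on L T (D `&` X1perp L N n)) /\
      (D `&` XNperp L N n <> zero_space L N ->
         op_nonneg_on L T (D `&` XNperp L N n)),
      op_nonneg_on L T (D `&` Xmean L N n) &
      Ker L T = spanG L Theta_n /\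
      spanG L Theta_n `<=` D `&` Xmean L N n].
Proof.
move=> D T Theta_n.
have omega0 := omega_gt0 homega.
pose t := @edge_t R Z omega N n.
have t01 : forall i, 0 < t i < 1 by move=> i; exact: edge_t01.
have sumt : \sum_i (t i)^-1 = - Z * Num.sqrt omega by exact: sum_edge_t.
have tE : forall i, Num.sqrt (1 - t i ^+ 2) = t_1 Z omega N n * t_N Z omega N n / t i.
  by move=> i; exact: edge_t_compl.
have tau0 : 0 < t_1 Z omega N n * t_N Z omega N n.
  have /andP[h1 _] := t_1_01 hZ hN hn homega.
  by have /andP[h2 _] := t_N_01 hZ hN hn homega; rewrite mulr_gt0.
have shiftE i : edge_shift Z omega n i = arctanh (t i) by exact: edge_shiftE.
have nonnegD v : D v -> 0 <= innerG L (op_fun T v) v.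
  move=> Dv; have [hH _ _] := Dv.
  have [P [P1 [Q [Q1 [d [e [rep slope sP sQ]]]]]]] := dom_delta'_representatives hN Dv.
  rewrite /innerG (eq_bigr (fun i =>
    (\int[lebesgue_measure]_(x in half_line L)
      (Lminus_real L omega (arctanh (t i)) (P i) (ReF (wderiv L (wderiv L (v i)))) x * P i x) +
     \int[lebesgue_measure]_(x in half_line L)
      (Lminus_real L omega (arctanh (t i)) (Q i) (ImF (wderiv L (wderiv L (v i)))) x * Q i x)) +i*
    (e * P i L - d * Q i L))); last first.
    move=> i _ /=; rewrite shiftE; have [hP hQ vPQ] := rep i.
    have [<- <-] := slope i.
    exact: Lminus_edge_inner (hH i).1.1 hP hQ vPQ.
  (* The order on [R[i]] also asks for a zero imaginary part: the Wronskians add up to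
     [e * (Z * d) - d * (Z * e) = 0]. *)
  rewrite sum_complex lecE /=; apply/andP; split.
    by rewrite big_split/= sumrN -!mulr_sumr sP sQ; apply/eqP; ring.
  rewrite big_split/=; apply: addr_ge0.
    by apply: (energy_ge0 omega0 t01 sumt (P1 := P1) _ _ sP) => [i|i]; [case: (rep i)|case: (slope i)].
  by apply: (energy_ge0 omega0 t01 sumt (P1 := Q1) _ _ sQ) => [i|i]; [case: (rep i)|case: (slope i)].
have spanD v : spanG L Theta_n v ->
    (D v /\ ae_equalG L (op_fun T v) (fun _ _ => 0)) /\ Xmean L N n v.
  move=> [v2 [c hc]].
  have H i := Cscale_H2 (real_H2_Psi L (arctanh (t i)) omega0) (v2 i) (c := c).
  have hv i : ae_equal L (v i) (Cscale c (Psi L omega (arctanh (t i)))).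
    by have := hc i; rewrite /Theta_n /Theta shiftE.
  split; [split|].
  - split=> [i|i j|i i0]; first by case: (H i (hv i)).
      have [_ _ _ ->] := H i (hv i); have [_ _ _ ->] := H j (hv j).
      by rewrite !(slope_boundary L omega0 t01 tE).
    rewrite (eq_bigr (fun j => c * (Psi L omega (arctanh (t j)) L)%:C)); last first.
      by move=> j _; case: (H j (hv j)).
    rewrite -mulr_sumr -rmorph_sum (sum_Psi_boundary L omega0 t01 sumt tE).
    have [_ _ _ ->] := H i (hv i).
    by rewrite (slope_boundary L omega0 t01 tE) rmorphM mulrCA.
  - move=> i /=; have [_ h2 _ _] := H i (hv i).
    apply: ae_half_lineI h2 (hv i) => x _ e2 e0.
    rewrite /Lminus_edge e2 e0 shiftE /Cscale.
    by apply/eqP; case: (c) => p q; rewrite eq_complex /=; apply/andP; split; apply/eqP; ring.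
  - have vij (i j : 'I_N) : (i < n)%N = (j < n)%N -> ae_equal L (v i) (v j).
      move=> ij; apply: ae_equal_trans (hc i) (ae_equal_sym _).
      by have := hc j; rewrite /Theta_n /Theta /edge_shift ij.
    split => // i j hi hj; apply: vij; first by rewrite hi hj.
    by rewrite !ltnNge hi hj.
split; [split|..].
- by move=> _ v [Dv _]; exact: nonnegD.
- by move=> _ v [Dv _]; exact: nonnegD.
- by move=> v [Dv _]; exact: nonnegD.
split; last by move=> v /spanD[[Dv _] Xv].
apply/seteqP; split=> [v [Dv v0]|v /spanD[]//].
have [hH _ _] := Dv.
have [P [P1 [Q [Q1 [d [e [rep slope sP sQ]]]]]]] := dom_delta'_representatives hN Dv.
split; first by move=> i; exact: (hH i).1.1.
pose kappa := - Num.sqrt omega * Num.sqrt (2 * omega) * (t_1 Z omega N n * t_N Z omega N n).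
have int0 i :
   \int[lebesgue_measure]_(x in half_line L)
      (Lminus_real L omega (arctanh (t i)) (P i) (ReF (wderiv L (wderiv L (v i)))) x * P i x) = 0 /\
   \int[lebesgue_measure]_(x in half_line L)
      (Lminus_real L omega (arctanh (t i)) (Q i) (ImF (wderiv L (wderiv L (v i)))) x * Q i x) = 0.
  have [hP hQ vPQ] := rep i; apply: (Lminus_edge_ae0 omega0 hP hQ vPQ).
  by have := v0 i; rewrite /= shiftE.
(* The complex slope of [v] at the vertex divided by [kappa], the real slope shared by all the
   profiles there. *)
exists (d / kappa +i* (e / kappa)) => i.
have [_ _ vPQ] := rep i.
apply: ae_half_lineS vPQ => x Lx ->; rewrite /Theta_n /Theta shiftE.
have -> := energy_eq0 omega0 t01 sumt tau0 tE (fun i => let: And3 h _ _ := rep i in h)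
  (fun i => (slope i).1) sP (fun i => (int0 i).1) i Lx.
have -> := energy_eq0 omega0 t01 sumt tau0 tE (fun i => let: And3 _ h _ := rep i in h)
  (fun i => (slope i).2) sQ (fun i => (int0 i).2) i Lx.
by apply/eqP; rewrite eq_complex /=; apply/andP; split; apply/eqP; ring.
Qed.
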